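(* Uniformly for $0\le x=o(n^{1/6})$, $$\frac{\mathbb P(Y_n>x)}{\overline\Phi(x)}=1+o(1)\qquad\text{and}\qquad \frac{\mathbb P(Y_n<-x)}{\overline\Phi(x)}=1+o(1)$$ as $n\to\infty$. That is, for every positive sequence $(b_n)_{n\ge1}$ with $b_n=o(n^{1/6})$, $$\sup_{0\le x\le b_n}\left|\frac{\mathbb P(Y_n>x)}{\overline\Phi(x)}-1\right|\to0\quad\text{and}\quad \sup_{0\le x\le b_n}\left|\frac{\mathbb P(Y_n<-x)}{\overline\Phi(x)}-1\right|\to0 .$$
   Context: Every $x\in(0,1)$ has a unique (infinite) Engel expansion $x=\frac1{q_1}+\frac1{q_1q_2}+\cdots+\frac1{q_1q_2\cdots q_n}+\cdots$ with integer digits $q_n=q_n(x)$ satisfying $q_{n+1}\ge q_n\ge2$. The expanded number is taken uniformly distributed on $(0,1)$, which makes the $q_n$ random variables. It is known that $(q_n)_{n\ge1}$ is then a time-homogeneous Markov chain on $\{2,3,\ldots\}$ with transition probabilities $\mathbb P(q_n=k\mid q_{n-1}=j)=\frac{j-1}{k(k-1)}$ for $k\ge j\ge2$, and initial distribution $\mathbb P(q_1=k)=\frac1{k(k-1)}$, $k\ge2$. Notation: $Y_n:=\frac{\log q_n-n}{\sqrt n}$; $\Phi$ is the standard normal distribution function and $\overline\Phi(x):=1-\Phi(x)$. *)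

(* Defs.v *)
From HB Require Import structures.
From mathcomp Require Import all_boot all_order all_algebra.
From mathcomp Require Import all_classical all_reals all_analysis.

Set Implicit Arguments.
Unset Strict Implicit.
Unset Printing Implicit Defensive.

Import Order.TTheory GRing.Theory Num.Theory.
Import numFieldNormedType.Exports.

Local Open Scope classical_set_scope.
Local Open Scope ring_scope.

(* Infinite Engel expansion of x. Sequences are indexed from 0 here, so that
   [q n] is the digit usually written q_{n+1}. *)
Definition is_engel_expansion (R : realType) (x : R) (q : nat -> nat) : Prop :=
  (forall n, (2 <= q n)%N /\ (q n <= q n.+1)%N) /\
  series (fun n => (\prod_(i < n.+1) (q i)%:R : R)^-1) @ \oo --> x.

(* The Engel expansion of x: for 0 < x < 1 it exists and is unique; a constant
   sequence is returned when x has no Engel expansion. *)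
Definition engel_expansion (R : realType) (x : R) : nat -> nat :=
  xget (fun=> 2%N) [set q | is_engel_expansion x q].

(* The n-th digit q_n(x), with n >= 1. *)
Definition engel_digit (R : realType) (x : R) (n : nat) : nat :=
  engel_expansion x n.-1.

(* Y_n as a function of the expanded number x, for n >= 1. *)
Definition engel_Y (R : realType) (n : nat) (x : R) : R :=
  (ln (engel_digit x n)%:R - n%:R) / Num.sqrt n%:R.

(* The equality of laws is required on measurable sets only, because
   [distribution P X] is a function of arbitrary sets. *)
Definition uniform01 (R : realType) (d : measure_display)
    (T : measurableType d) (P : probability T R) (X : {RV P >-> R}) : Prop :=
  forall A : set R, measurable A ->
    distribution P X A = uniform_prob (@ltr01 R) A.

Definition Phi (R : realType) (x : R) : R :=
  fine (normal_prob 0 1 `]-oo, x]).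

Definition Phibar (R : realType) (x : R) : R := 1 - Phi x.

(* Main.v *)
Require Import Defs.
From HB Require Import structures.
From mathcomp Require Import all_boot all_order all_algebra.
From mathcomp Require Import all_classical all_reals all_analysis.
From mathcomp Require Import ring lra.

Import Order.TTheory GRing.Theory Num.Theory.
Import numFieldNormedType.Exports.

Local Open Scope classical_set_scope.
Local Open Scope ring_scope.

(** Write A for a digit minus one.  Given its value at one step, the next value
    is the integer part of A / U with U uniform on (0,1), so that the
    probability that it exceeds k is the mean of the probabilities that the
    present value exceeds 0, 1, ..., k.  The tail of the n-th digit is therefore
    the n-th iterate of the Cesaro mean operator on the indicator of 0
    ([engel_tail], [uniform_engel_digit]).

    Without the rounding, log A would be a sum S of n independent standard
    exponential variables, with tail [gamma_tail n].  The rounding is harmless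
    for an exact reason: a Cesaro matrix is a Hausdorff matrix, which gives
    P(A > k) = E[(1 - exp (- S)) ^ k].  Two one-sided bounds are enough,
    [engel_tail_le] and [engel_tail_ge], and both are proved by induction on n
    from the derivatives of the functions involved, without any integral.
    Together they place the tail of the digit between two values of the gamma
    tail whose arguments differ by 1 + s, for any s >= 0, up to an error
    exp (- s) ([engel_tail_sandwich]).

    What is left is a moderate deviation estimate for the gamma law.  On the
    scale y = (s - n) / sqrt n its density is a constant times the normal
    density, up to a factor exp (O(B ^ 3 / sqrt n)) when |y| <= B
    ([std_gamma_pdf_local]); integration gives the same comparison for the
    increments of the two distribution functions.  Both tails beyond B are
    controlled by the density at B, hence the constant is close to 1 because
    both laws have total mass 1, and Stirling's formula can be avoided
    ([std_gamma_normal]).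

    The parameters are balanced as follows.  Take B = c n ^ (1/6) with a small
    constant c and truncate at B; use B ^ 2 as the shift s above.  For
    0 <= x <= B / 4 the errors phi B and exp (- B ^ 2) are negligible with
    respect to [Phibar x] by Mills' inequality ([phi_le_far]), and the shift
    B ^ 2 / sqrt n of the argument changes [Phibar x] by a factor
    1 + O(B ^ 3 / sqrt n) ([Phibar_shift]).  All relative errors are thus small
    when c is small and n is large ([relative_error]), and b_n = o(n ^ (1/6))
    is eventually at most B / 4 for each fixed c. *)

(** * Derivatives of real functions *)

(** All comparisons of functions below are made on their derivatives; this form
    of the mean value theorem turns them into inequalities. *)
Lemma le_of_derive_ge0 {R : realType} {f df : R -> R} {a b : R} : a <= b ->
  (forall x, a <= x <= b -> is_derive x 1 f (df x)) ->
  (forall x, a <= x <= b -> 0 <= df x) -> f a <= f b.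
Proof.
move=> ab fdf df0.
have [c] : exists2 c, c \in `[a, b]%R & f b - f a = df c * (b - a).
  apply: MVT_segment => // [x|];
    first by rewrite in_itv/= => /andP[/ltW ax /ltW xb]; apply: fdf; rewrite ax.
  apply: derivable_within_continuous => x; rewrite in_itv/= => xab.
  by have [] := fdf x xab.
rewrite in_itv/= => cab e.
by rewrite -subr_ge0 e mulr_ge0 ?subr_ge0 ?df0.
Qed.

Lemma is_derive_funM {R : realType} {f g : R -> R} {x a b : R} :
  is_derive x 1 f a -> is_derive x 1 g b ->
  is_derive x 1 (fun y => f y * g y) (a * g x + f x * b).
Proof.
move=> fa gb; apply: (is_derive_eq (is_deriveM fa gb)).
by rewrite addrC /GRing.scale/= [g x * a]mulrC.
Qed.

Lemma is_derive_funZ {R : realType} {f : R -> R} {x a : R} (c : R) :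
  is_derive x 1 f a -> is_derive x 1 (fun y => c * f y) (c * a).
Proof.
move=> fa; have := is_derive_funM (is_derive_cst c x 1) fa.
by rewrite mul0r add0r.
Qed.

Lemma is_derive_funX {R : realType} {f : R -> R} {x a : R} (n : nat) :
  is_derive x 1 f a ->
  is_derive x 1 (fun y => f y ^+ n) (n%:R * f x ^+ n.-1 * a).
Proof.
move=> fa; have := is_deriveX n fa.
by rewrite exprfctE.
Qed.

Lemma is_derive_expRN {R : realType} (t : R) :
  is_derive t 1 (fun s => expR (- s)) (- expR (- t)).
Proof.
have := @is_derive1_comp R expR -%R t (expR (- t)) (-1) _ _.
by rewrite mulrN1; apply.
Qed.

(** * Iterated Cesaro means and gamma tails *)

Definition cesaro {R : realType} (f : nat -> R) (k : nat) : R :=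
  (\sum_(i < k.+1) f i) / k.+1%:R.

(** The probability of n under the Poisson law of parameter t, which is also the
    density at t of the gamma law of shape n + 1. *)
Definition poisson {R : realType} (n : nat) (t : R) : R :=
  expR (- t) * (t ^+ n / n`!%:R).

(** The tail at t of the gamma law of shape n (a sum of n standard exponential
    variables): such a sum exceeds t when a Poisson process of rate 1 has fewer
    than n points in [0, t]. *)
Definition gamma_tail {R : realType} (n : nat) (t : R) : R :=
  \sum_(i < n) poisson i t.

Lemma is_derive_exp_term {R : realType} (n : nat) (t : R) :
  is_derive t 1 (fun s : R => s ^+ n.+1 / n.+1`!%:R) (t ^+ n / n`!%:R).
Proof.
under eq_fun do rewrite mulrC.
apply: (is_derive_eq (is_derive_funZ _ (is_derive_funX n.+1 (is_derive_id t
  1)))).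
rewrite factS natrM mulr1 /=.
by field; rewrite nat1r !pnatr_eq0 -lt0n fact_gt0.
Qed.

Lemma is_derive_poisson0 {R : realType} (t : R) :
  is_derive t 1 (poisson 0) (- poisson 0 t).
Proof.
have -> : (poisson 0 : R -> R) = (fun s => expR (- s)).
  by apply/funext => s; rewrite /poisson expr0 fact0 divr1 mulr1.
exact: is_derive_expRN.
Qed.

Lemma is_derive_poissonS {R : realType} (n : nat) (t : R) :
  is_derive t 1 (poisson n.+1) (poisson n t - poisson n.+1 t).
Proof.
apply: (is_derive_eq (is_derive_funM (is_derive_expRN t) (is_derive_exp_term n
  t))).
by rewrite /poisson; ring.
Qed.

Lemma is_derive_gamma_tail {R : realType} (n : nat) (t : R) :
  is_derive t 1 (gamma_tail n.+1) (- poisson n t).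
Proof.
elim: n => [|n IH].
  have -> : gamma_tail 1 = poisson 0 :> (R -> R).
    by apply/funext => s; rewrite /gamma_tail big_ord1.
  exact: is_derive_poisson0.
have -> : gamma_tail n.+2 = gamma_tail n.+1 + poisson n.+1 :> (R -> R).
  by apply/funext => s; rewrite /gamma_tail big_ord_recr.
have := is_deriveD IH (is_derive_poissonS n t).
by rewrite addrA addNr add0r.
Qed.

Lemma poisson_ge0 {R : realType} (n : nat) (t : R) : 0 <= t -> 0 <= poisson n t.
Proof.
by move=> t0; rewrite /poisson mulr_ge0 ?expR_ge0// divr_ge0 ?exprn_ge0 ?ler0n.
Qed.

Lemma poissonS {R : realType} (n : nat) (t : R) :
  n.+1%:R * poisson n.+1 t = t * poisson n t.
Proof.
rewrite /poisson factS natrM exprS.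
by field; rewrite nat1r !pnatr_eq0 -lt0n fact_gt0.
Qed.

Lemma gamma_tail_at0 {R : realType} (n : nat) : gamma_tail n.+1 (0 : R) = 1.
Proof.
rewrite /gamma_tail big_ord_recl big1 => [|i _].
  by rewrite /poisson oppr0 expR0 expr0 fact0 divr1 mulr1 addr0.
by rewrite /poisson /= expr0n /= mul0r mulr0.
Qed.

Lemma gamma_tailS {R : realType} (n : nat) (t : R) :
  gamma_tail n.+1 t = gamma_tail n t + poisson n t.
Proof. by rewrite /gamma_tail big_ord_recr. Qed.

Lemma gamma_tail_ge0 {R : realType} (n : nat) (t : R) :
  0 <= t -> 0 <= gamma_tail n t.
Proof. by move=> t0; apply: sumr_ge0 => i _; apply: poisson_ge0. Qed.

Lemma gamma_tail_decr {R : realType} (n : nat) (s t : R) :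
  0 <= s -> s <= t -> gamma_tail n.+1 t <= gamma_tail n.+1 s.
Proof.
move=> s0 st; rewrite -lerN2.
apply: (@le_of_derive_ge0 _ (fun u => - gamma_tail n.+1 u) (poisson n)) =>
  // u /andP[su _].
  by apply: (is_derive_eq (is_deriveN (is_derive_gamma_tail n u)));
    rewrite opprK.
by rewrite poisson_ge0// (le_trans s0).
Qed.

Lemma gamma_tail_le1 {R : realType} (n : nat) (t : R) :
  0 <= t -> gamma_tail n t <= 1.
Proof.
case: n => [|n] t0; first by rewrite /gamma_tail big_ord0 ler01.
by rewrite -(gamma_tail_at0 n) gamma_tail_decr.
Qed.

Lemma cesaroD {R : realType} (f g : nat -> R) (k : nat) :
  cesaro (fun i => f i + g i) k = cesaro f k + cesaro g k.
Proof. by rewrite /cesaro big_split mulrDl. Qed.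

Lemma cesaroZ {R : realType} (c : R) (f : nat -> R) (k : nat) :
  cesaro (fun i => c * f i) k = c * cesaro f k.
Proof. by rewrite /cesaro -mulr_sumr mulrA. Qed.

Lemma le_cesaro {R : realType} (f g : nat -> R) (k : nat) :
  (forall i, (i <= k)%N -> f i <= g i) -> cesaro f k <= cesaro g k.
Proof.
move=> fg; rewrite /cesaro ler_wpM2r ?invr_ge0 ?ler0n// ler_sum// => i _.
by apply: fg; rewrite -ltnS.
Qed.

Lemma cesaro_cst {R : realType} (c : R) (k : nat) : cesaro (fun=> c) k = c.
Proof.
by rewrite /cesaro sumr_const card_ord -[X in X / _]mulr_natr mulfK// pnatr_eq0.
Qed.

(** The probability that q_n - 1 exceeds k. The chain q - 1 starts from 1,
    which is the case n = 0. *)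
Definition engel_tail {R : realType} (n k : nat) : R :=
  iter n cesaro (fun i => (i == 0%N)%:R) k.

Lemma engel_tail1 {R : realType} (k : nat) : engel_tail 1 k = k.+1%:R^-1 :> R.
Proof.
rewrite /engel_tail /= /cesaro big_ord_recl big1 => [|i _]; last by [].
by rewrite addr0 mul1r.
Qed.

Lemma engel_tailS {R : realType} (n k : nat) :
  engel_tail n.+1 k = cesaro (engel_tail n) k :> R.
Proof. by []. Qed.

(** The continuous counterpart of the Cesaro recursion: with r = expR t, the
    function r * gamma_tail (n + 2) (ln r) is a primitive in r of
    gamma_tail (n + 1) (ln r). *)
Lemma is_derive_expR_gamma_tail {R : realType} (n : nat) (t : R) :
  is_derive t 1 (fun s =>
    expR s * gamma_tail n.+2 s) (expR t * gamma_tail n.+1 t).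
Proof.
apply: (is_derive_eq (is_derive_funM (is_derive_expR t) (is_derive_gamma_tail
  n.+1 t))).
by rewrite [gamma_tail n.+2 t]gamma_tailS; ring.
Qed.

(** Rounding down can only decrease the chain, so its tail is at most the one
    of the chain without rounding.  Analytically: the Cesaro mean of a
    decreasing function of ln i is a right Riemann sum, which is below the
    integral mean. *)
Lemma engel_tail_le {R : realType} (n k : nat) :
  engel_tail n.+1 k <= gamma_tail n.+1 (ln k.+1%:R) :> R.
Proof.
have lnk i : (0 : R) <= ln i.+1%:R by rewrite ln_ge0// ler1n.
have expln i : expR (ln i.+1%:R) = i.+1%:R :> R by rewrite lnK// posrE ltr0Sn.
elim: n k => [|n IH] k.
  by rewrite engel_tail1 /gamma_tail big_ord1 /poisson expRN expln expr0 fact0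
    divr1 mulr1.
rewrite engel_tailS /cesaro ler_pdivrMr ?ltr0Sn// mulrC -{1}(expln k).
apply: (@le_trans _ _ (\sum_(i < k.+1) gamma_tail n.+1 (ln i.+1%:R))).
  by apply: ler_sum => i _; apply: IH.
elim: k => [|k IHk].
  by rewrite big_ord1 ln1 expR0 mul1r !gamma_tail_at0.
rewrite big_ord_recr/= -lerBrDl.
rewrite -[leLHS]mul1r.
set c := gamma_tail n.+1 _.
have kk : ln k.+1%:R <= ln k.+2%:R :> R
  by rewrite ler_ln ?posrE ?ltr0Sn// ler_nat.
have H : expR (ln k.+1%:R) * gamma_tail n.+2 (ln k.+1%:R) - c * expR (ln
  k.+1%:R) <=
    expR (ln k.+2%:R) * gamma_tail n.+2 (ln k.+2%:R) - c * expR (ln k.+2%:R).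
  apply: (@le_of_derive_ge0 R (fun s => expR s * gamma_tail n.+2 s - c * expR s)
    (fun s => expR s * gamma_tail n.+1 s - c * expR s)) => // s /andP[sl su].
    exact: is_deriveB (is_derive_expR_gamma_tail n s) (is_derive_funZ c
      (is_derive_expR s)).
  rewrite [c * _]mulrC -mulrBr mulr_ge0 ?expR_ge0// subr_ge0.
  by apply: gamma_tail_decr => //; apply: le_trans sl.
rewrite lerBrDr; apply: le_trans (lerD (lexx _) IHk) _.
move: H; rewrite !expln -[k.+2%:R]natr1 => H; lra.
Qed.

(** The integral of poisson (n - 1) s * (1 - expR (- s)) ^+ k over s > t.
    Integration by parts turns the integral for n + 1 into a Cesaro mean of the
    integrals for n plus a boundary term, which is the recursion used here as a
    definition.  At t = 0 the boundary terms vanish, except the first one, which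
    is the indicator of 0: the Engel tail remains. *)
Definition capped_tail {R : realType} (t : R) : nat -> nat -> R :=
  fix J n := if n is m.+1
    then cesaro (fun i => J m i + poisson m t * (1 - expR (- t)) ^+ i)
    else fun=> 0.

Lemma capped_tail_at0 {R : realType} (n k : nat) :
  capped_tail (0 : R) n.+1 k = engel_tail n.+1 k.
Proof.
elim: n k => [|n IH] k.
  rewrite engel_tailS /=; congr (cesaro _ k); apply/funext => i.
  by rewrite add0r /poisson oppr0 expR0 subrr expr0 fact0 divr1 !mul1r expr0n.
rewrite engel_tailS [LHS]/=; congr (cesaro _ k); apply/funext => i.
have -> : poisson n.+1 (0 : R) = 0 by rewrite /poisson expr0n /= mul0r mulr0.
by rewrite mul0r addr0 -IH.
Qed.

Lemma is_derive_cesaro {R : realType} (f : R -> nat -> R) (df : nat -> R)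
    (t : R) (k : nat) :
  (forall i, is_derive t 1 (f^~ i) (df i)) ->
  is_derive t 1 (fun s => cesaro (f s) k) (cesaro df k).
Proof.
move=> fd; rewrite /cesaro; under eq_fun do rewrite mulrC.
rewrite [X in is_derive _ _ _ X]mulrC.
apply: is_derive_funZ.
have := @is_derive_sum R R R k.+1 (fun i s => f s i) t 1 (fun i => df i).
by rewrite fct_sumE; apply.
Qed.

Lemma is_derive_cap {R : realType} (i : nat) (t : R) :
  is_derive t 1 (fun s => (1 - expR (- s)) ^+ i)
    (i%:R * (1 - expR (- t)) ^+ i.-1 * expR (- t)).
Proof.
apply: is_derive_funX.
have := is_deriveB (is_derive_cst (1 : R) t 1) (is_derive_expRN t).
by rewrite sub0r opprK.
Qed.

(** Telescoping: the summand of index i is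
    i (1 - u)^(i-1) - (i + 1) (1 - u)^i. *)
Lemma cesaro_cap {R : realType} (u : R) (k : nat) :
  cesaro (fun i => i%:R * (1 - u) ^+ i.-1 * u - (1 - u) ^+ i) k =
    - (1 - u) ^+ k.
Proof.
rewrite /cesaro.
have -> : \sum_(i < k.+1) (i%:R * (1 - u) ^+ i.-1 * u - (1 - u) ^+ i) =
    - (k.+1%:R * (1 - u) ^+ k) :> R.
  elim: k => [|k IH]; first by rewrite big_ord1 /= !expr0; ring.
  by rewrite big_ord_recr IH /= exprS; ring.
by rewrite mulrC mulrN mulKf// pnatr_eq0.
Qed.

(** The recursion does define the announced integral: the sums of the
    derivatives collapse by [cesaro_cap]. *)
Lemma is_derive_capped_tail {R : realType} (n k : nat) (t : R) :
  is_derive t 1 (fun s => capped_tail s n.+1 k)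
    (- (poisson n t * (1 - expR (- t)) ^+ k)).
Proof.
elim: n k => [|n IH] k /=.
  apply: (is_derive_eq (is_derive_cesaro _ _ _ _ (fun i =>
    is_deriveD (is_derive_cst 0 t 1)
      (is_derive_funM (is_derive_poisson0 t) (is_derive_cap i t))))).
  rewrite -[RHS]mulrN -cesaro_cap -cesaroZ; congr (cesaro _ k).
  by apply/funext => i; ring.
apply: (is_derive_eq (is_derive_cesaro _ _ _ _ (fun i =>
    is_deriveD (IH i)
      (is_derive_funM (is_derive_poissonS n t) (is_derive_cap i t))))).
rewrite -[RHS]mulrN -cesaro_cap -cesaroZ; congr (cesaro _ k).
by apply/funext => i; ring.
Qed.

Lemma cap_itv {R : realType} (t : R) : 0 <= t -> 0 <= 1 - expR (- t) <= 1.
Proof.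
move=> t0; rewrite subr_ge0 expR_le1 oppr_le0 t0 /=.
by rewrite gerBl expR_ge0.
Qed.

Lemma capped_tail_decr {R : realType} (n k : nat) (t : R) : 0 <= t ->
  capped_tail t n.+1 k <= capped_tail 0 n.+1 k.
Proof.
move=> t0; rewrite -lerN2.
apply: (@le_of_derive_ge0 _ (fun u => - capped_tail u n.+1 k)
  (fun u => poisson n u * (1 - expR (- u)) ^+ k)) => // u /andP[u0 _].
  by apply: (is_derive_eq (is_deriveN (is_derive_capped_tail n k u)));
    rewrite opprK.
have /andP[p0 _] := cap_itv u u0.
by rewrite mulr_ge0 ?poisson_ge0 ?exprn_ge0.
Qed.

(** On s > t the factor (1 - expR (- s)) ^+ k is at least its value at t. *)
Lemma capped_tail_ge {R : realType} (n k : nat) (t : R) : 0 <= t ->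
  (1 - expR (- t)) ^+ k * gamma_tail n t <= capped_tail t n k.
Proof.
move=> t0; have /andP[p0 p1] := cap_itv t t0.
elim: n k => [|n IH] k; first by rewrite /gamma_tail big_ord0 mulr0.
rewrite /= gamma_tailS -[leLHS](cesaro_cst _ k); apply: le_cesaro => i ik.
apply: le_trans (lerD (IH i) (lexx _)).
rewrite [poisson n t * _]mulrC -mulrDr ler_wpM2r//.
  by rewrite addr_ge0 ?gamma_tail_ge0 ?poisson_ge0.
by apply: ler_wiXn2l.
Qed.

(** If a sum S of exponential variables exceeds t, then (1 - expR (- S)) ^+ k is
    at least (1 - expR (- t)) ^+ k, and the Engel tail is the mean of the former
    quantity. *)
Lemma engel_tail_ge {R : realType} (n k : nat) (t : R) : 0 <= t ->
  (1 - expR (- t)) ^+ k * gamma_tail n.+1 t <= engel_tail n.+1 k.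
Proof.
move=> t0; apply: le_trans (capped_tail_ge _ _ _ t0) _.
by rewrite -capped_tail_at0 capped_tail_decr.
Qed.

Lemma bernoulli_ge {R : realType} (u : R) (k : nat) : 0 <= u <= 1 ->
  1 - k%:R * u <= (1 - u) ^+ k.
Proof.
move=> /andP[u0 u1]; elim: k => [|k IH]; first by rewrite mul0r subr0 expr0.
rewrite exprS.
apply: le_trans (_ : _ <= (1 - u) * (1 - k%:R * u)) _.
  rewrite -natr1.
  have : 0 <= (k%:R : R) * (u * u) by rewrite !mulr_ge0 ?ler0n.
  by lra.
by rewrite ler_wpM2l// subr_ge0.
Qed.

(** The upper bound is [engel_tail_le], the unit absorbing the distance from
    ln (k + 1) to tau.  In the lower bound, [engel_tail_ge] is used at the level
    tau + c: there k * expR (- (tau + c)) <= expR (- c), and Bernoulli's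
    inequality bounds the loss. *)
Lemma engel_tail_sandwich {R : realType} (n k : nat) (tau c : R) :
  1 <= tau -> 0 <= c -> expR tau - 1 <= k.+1%:R <= expR tau ->
  gamma_tail n.+1 (tau + c) - expR (- c) <= engel_tail n.+1 k
    <= gamma_tail n.+1 (tau - 1).
Proof.
move=> tau1 c0 /andP[kl ku]; apply/andP; split.
  have t0 : 0 <= tau + c by rewrite addr_ge0// (le_trans _ tau1).
  apply: le_trans (engel_tail_ge _ k _ t0).
  have uc : k%:R * expR (- (tau + c)) <= expR (- c).
    rewrite opprD expRD mulrA ler_piMl ?expR_ge0//.
    rewrite expRN ler_pdivrMr ?expR_gt0// mul1r (le_trans _ ku)//.
    by rewrite ler_nat.
  have /andP[u0 u1] : 0 <= expR (- (tau + c)) <= 1.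
    by rewrite expR_ge0 expR_le1 oppr_le0.
  have b := bernoulli_ge (expR (- (tau + c))) k _.
  rewrite u0 u1 in b.
  apply: le_trans (_ : _ <= (1 - expR (- c)) * gamma_tail n.+1 (tau + c)) _.
    rewrite mulrBl mul1r lerB// ler_piMr ?expR_ge0//.
    exact: gamma_tail_le1.
  apply: ler_wpM2r; first exact: gamma_tail_ge0.
  by apply: le_trans (b isT); rewrite lerB.
apply: le_trans (engel_tail_le _ _) _.
apply: gamma_tail_decr; first by rewrite subr_ge0.
rewrite -ler_expR lnK ?posrE ?ltr0Sn//.
apply: le_trans kl.
rewrite expRB.
have e1 : 2 <= expR 1 :> R by have := expR_ge1Dx (1 : R); lra.
have et : 2 <= expR tau by apply: le_trans e1 _; rewrite ler_expR.
rewrite ler_pdivrMr ?expR_gt0//.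
have : (expR tau - 1) * 2 <= (expR tau - 1) * expR 1.
  by rewrite ler_wpM2l//; lra.
lra.
Qed.

(** * The normal distribution *)

Definition phi {R : realType} (x : R) : R := normal_pdf 0 1 x.

Lemma phiE {R : realType} (x : R) : phi x = phi 0 * expR (- (x ^+ 2 / 2)).
Proof.
rewrite /phi normal_pdfE ?oner_eq0// /normal_fun !subr0 expr1n expr0n /= oppr0.
by rewrite mul0r expR0 mulr1 mulNr.
Qed.

Lemma phi_gt0 {R : realType} (x : R) : 0 < phi x.
Proof.
by rewrite /phi normal_pdfE ?oner_eq0// mulr_gt0 ?expR_gt0// normal_peak_gt0
  ?oner_eq0.
Qed.

Lemma phiN {R : realType} (x : R) : phi (- x) = phi x.
Proof. by rewrite phiE sqrrN -phiE. Qed.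

Lemma le_phi {R : realType} (x y : R) : 0 <= x -> x <= y -> phi y <= phi x.
Proof.
move=> x0 xy; rewrite phiE [leRHS]phiE ler_wpM2l ?(ltW (phi_gt0 _))//.
by rewrite ler_expR lerN2 ler_wpM2r// lerXn2r// nnegrE (le_trans x0).
Qed.

Lemma is_derive_Phi {R : realType} (x : R) : is_derive x 1 (@Phi R) (phi x).
Proof.
have [||||d e] := @continuous_FTC1 R (normal_pdf 0 1) -oo%O x (x + 1).
- by rewrite ltrDl.
- by apply: integrableS (integrable_normal_pdf 0 1) => //.
- by rewrite ltNyr.
- by apply: continuous_normal_pdf; rewrite oner_eq0.
have -> : @Phi R = (fun y =>
  \int[lebesgue_measure]_(t in `]-oo, y]) normal_pdf 0 1 t).
  by apply/funext => y.
by rewrite /phi -e derive1E; apply: derivableP.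
Qed.

Lemma is_derive_Phibar {R : realType} (x : R) : is_derive x 1 (@Phibar R) (-
  phi x).
Proof.
have := is_deriveB (is_derive_cst (1 : R) x 1) (is_derive_Phi x).
by rewrite sub0r.
Qed.

Lemma normal_fin {R : realType} (x : R) : normal_prob 0 1 `]-oo,
  x] \is a fin_num.
Proof. by rewrite fin_num_measure. Qed.

Lemma Phi_ge0 {R : realType} (x : R) : 0 <= Phi x.
Proof. by rewrite /Phi fine_ge0. Qed.

Lemma Phi_le1 {R : realType} (x : R) : Phi x <= 1.
Proof. by rewrite /Phi -lee_fin fineK ?probability_le1// normal_fin. Qed.

Lemma Phibar_ge0 {R : realType} (x : R) : 0 <= Phibar x.
Proof. by rewrite subr_ge0 Phi_le1. Qed.

Lemma cvg_Phi {R : realType} :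
  Phi x @[x --> +oo] --> (1 : R) /\ Phi x @[x --> -oo] --> (0 : R).
Proof.
pose idR : measurableTypeR R -> R := idfun.
pose X : {RV normal_prob (0 : R) 1 >-> R} :=
  HB.pack idR (@isMeasurableFun.Build _ _ _ _ idR (@measurable_id _ _ setT)).
have e : (fine \o cdf X) = @Phi R by apply/funext.
split; rewrite -e; apply/fine_cvg.
- exact: cvg_cdfy1.
- exact: cvg_cdfNy0.
Qed.

Lemma Phi_nondecreasing {R : realType} (x y : R) : x <= y -> Phi x <= Phi y.
Proof.
move=> xy; apply: (le_of_derive_ge0 (df := phi)) => // z _;
  first exact: is_derive_Phi.
exact/ltW/phi_gt0.
Qed.

Lemma Phibar_nonincreasing {R : realType} (x y : R) : x <= y ->
  Phibar y <= Phibar x.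
Proof. by move=> xy; rewrite lerD2l lerN2 Phi_nondecreasing. Qed.

(** The sum Phi x + Phi (- x) has derivative 0 by symmetry of the density, and
    limit 1 at infinity. *)
Lemma PhiN {R : realType} (x : R) : Phi (- x) = Phibar x.
Proof.
pose f (y : R) := Phi y + Phi (- y).
have df (y : R) : is_derive y 1 f 0.
  have h : is_derive y 1 (fun z => Phi (- z)) (- phi y).
    have := @is_derive1_comp R (@Phi R) -%R y (phi y) (-1) _ _.
    rewrite mulrN1; apply => //.
    by rewrite -phiN; apply: is_derive_Phi.
  by have := is_deriveD (is_derive_Phi y) h; rewrite subrr.
have fc (y z : R) : y <= z -> f y = f z.
  move=> yz; apply/eqP; rewrite eq_le; apply/andP; split.
    by apply: (le_of_derive_ge0 (df := fun=> 0)).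
  rewrite -lerN2; apply: (le_of_derive_ge0 (f := fun y =>
    - f y) (df := fun=> 0)) => // u _.
  by apply: (is_derive_eq (is_deriveN (df u))); rewrite oppr0.
have fx : f y @[y --> +oo] --> f x.
  apply: (@cvg_trans _ ((fun=> f x) y @[y --> +oo])); last exact: cvg_cst.
  apply: near_eq_cvg; near=> y; apply: fc; near: y.
  by apply: nbhs_pinfty_ge; exact: num_real.
have f1 : f y @[y --> +oo] --> (1 + 0 : R).
  apply: cvgD; first exact: cvg_Phi.1.
  exact: ((cvgNy_compNP (@Phi R) _).1 cvg_Phi.2).
have := cvg_unique (@Rhausdorff R) fx f1.
rewrite /f addr0 /Phibar => <-.
by rewrite addrAC subrr add0r.
Unshelve. all: by end_near. Qed.

Lemma Phibar_diff_le {R : realType} (x h : R) : 0 <= x -> 0 <= h ->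
  h * phi (x + h) <= Phibar x - Phibar (x + h) <= h * phi x.
Proof.
move=> x0 h0.
have dl (c u : R) : is_derive u 1 (fun z => c * z + Phibar z) (c - phi u).
  have h1 : c * 1 + - phi u = c - phi u by rewrite mulr1.
  exact: (is_derive_eq (is_deriveD (is_derive_funZ c (is_derive_id u 1))
    (is_derive_Phibar u)) h1).
have xh : x <= x + h by rewrite lerDl.
have Hl : - (phi (x + h) * x + Phibar x)
  <= - (phi (x + h) * (x + h) + Phibar (x + h)).
  apply: (@le_of_derive_ge0 R (fun z => - (phi (x + h) * z + Phibar z))
    (fun z => - (phi (x + h) - phi z)) x (x + h) xh) => u /andP[ul uu].
  by rewrite oppr_ge0 subr_le0 le_phi// (le_trans x0).
have Hu : phi x * x + Phibar x <= phi x * (x + h) + Phibar (x + h).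
  apply: (@le_of_derive_ge0 R (fun z => phi x * z + Phibar z)
    (fun z => phi x - phi z) x (x + h) xh) => u /andP[ul uu].
  by rewrite subr_ge0 le_phi.
move: Hl Hu; move: (phi (x + h)) (phi x) (Phibar x) (Phibar (x + h)) =>
  a b c d Hl Hu.
by apply/andP; split; lra.
Qed.

(** A lower bound of Mills type.  The interval from x to x + h with
    h = 1 / (1 + x) is so short that the density loses at most a factor
    expR (3 / 2) on it, because (x + h) ^+ 2 <= x ^+ 2 + 3. *)
Lemma phi_le_Phibar {R : realType} (x : R) : 0 <= x ->
  phi x <= expR (3 / 2) * (1 + x) * Phibar x.
Proof.
move=> x0; have x1 : 0 < 1 + x by lra.
have h0 : 0 <= (1 + x)^-1 by rewrite invr_ge0 ltW.
have /andP[+ _] := Phibar_diff_le _ _ x0 h0.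
set h := (1 + x)^-1 => H.
have h1 : h <= 1 by rewrite invf_le1// lerDl.
have hx : h * (1 + x) = 1 by rewrite mulVf// gt_eqF.
have hx1 : h * x <= 1 by nra.
have e : phi x <= expR (3 / 2) * phi (x + h).
  rewrite phiE [in leRHS]phiE mulrCA ler_wpM2l ?(ltW (phi_gt0 _))//.
  rewrite -expRD ler_expR.
  by nra.
apply: le_trans e _; rewrite -mulrA ler_wpM2l ?expR_ge0//.
have : h * phi (x + h) <= Phibar x by have := Phibar_ge0 (x + h); lra.
move=> /(ler_wpM2l (ltW x1)); by rewrite mulrA [(1 + x) * h]mulrC hx mul1r.
Qed.

Lemma Phibar_gt0 {R : realType} (x : R) : 0 < Phibar x.
Proof.
have [x0|x0] := leP 0 x.
  have := lt_le_trans (phi_gt0 x) (phi_le_Phibar x x0).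
  by rewrite pmulr_rgt0// mulr_gt0 ?expR_gt0//; lra.
apply: lt_le_trans (Phibar_nonincreasing _ _ (ltW x0)).
have := lt_le_trans (phi_gt0 0) (phi_le_Phibar (0 : R) (lexx _)).
by rewrite pmulr_rgt0// mulr_gt0 ?expR_gt0// addr0 ltr01.
Qed.

Lemma is_derive_phi {R : realType} (x : R) : is_derive x 1 phi (- (x * phi x)).
Proof.
have -> : phi = (fun y : R => phi 0 * expR (- (y ^+ 2 / 2))).
  by apply/funext => y; rewrite -phiE.
have h : is_derive x 1 (fun y : R => - (y ^+ 2 / 2)) (- x).
  under eq_fun do rewrite [_ / _]mulrC.
  apply: (is_derive_eq (is_deriveN (is_derive_funZ 2^-1 (is_derive_funX 2
    (is_derive_id x 1))))).
  by rewrite /= expr1 mulr1; field.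
have := is_derive_funZ (phi 0) (@is_derive1_comp R expR _ x _ _ (is_derive_expR
  _) h).
rewrite -phiE => h2; apply: (is_derive_eq h2).
by rewrite [in RHS]phiE; ring.
Qed.

(** For x >= 1 the function Phibar - phi is nondecreasing, with limit 0 at
    infinity. *)
Lemma Phibar_le_phi {R : realType} (x : R) : 1 <= x -> Phibar x <= phi x.
Proof.
move=> x1.
have H (y : R) : x <= y -> Phibar x - phi x <= Phibar y.
  move=> xy; apply: le_trans (_ : _ <= Phibar y - phi y) _.
    apply: (@le_of_derive_ge0 R (fun z => Phibar z - phi z)
      (fun z => - phi z - - (z * phi z))) => // u /andP[ul uu].
      exact: is_deriveB (is_derive_Phibar _) (is_derive_phi _).
    have := phi_gt0 u; nra.
  by rewrite gerBl ltW ?phi_gt0.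
rewrite -subr_le0.
have c : Phibar y @[y --> +oo] --> (1 - 1 : R).
  by apply: cvgB; [exact: cvg_cst|exact: cvg_Phi.1].
rewrite subrr in c.
apply: (cvgr_to_ge c); near=> y; apply: H; near: y.
by apply: nbhs_pinfty_ge; exact: num_real.
Unshelve. all: by end_near. Qed.

(** * Engel expansions *)

Definition engel_partial_sum {R : realType} (q : nat -> nat) : nat -> R :=
  series (fun n => (\prod_(i < n.+1) (q i)%:R)^-1).

(** Removing the first digit of an expansion of x gives an expansion of
    q_1 x - 1; at the level of partial sums this is Horner's rule. *)
Lemma engel_partial_sumS {R : realType} (q : nat -> nat) (n : nat) :
  engel_partial_sum q n.+1 =
  (1 + engel_partial_sum (fun i => q i.+1) n) / (q 0)%:R :> R.
Proof.
rewrite /engel_partial_sum /series /= big_nat_recl// mulrDl mul1r.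
congr (_ + _); first by rewrite big_ord1.
rewrite mulr_suml; apply: eq_bigr => i _.
by rewrite big_ord_recl invfM mulrC.
Qed.

(** The extreme case is the constant sequence, whose series is geometric with
    sum 1 / (q_1 - 1). *)
Lemma engel_partial_sum_le {R : realType} (q : nat -> nat) (n : nat) :
  (forall i, (2 <= q i)%N /\ (q i <= q i.+1)%N) ->
  engel_partial_sum q n <= ((q 0).-1%:R)^-1 :> R.
Proof.
elim: n q => [|n IH] q qP.
  by rewrite /engel_partial_sum /series /= big_geq// invr_ge0 ler0n.
rewrite engel_partial_sumS.
have [q0 q01] := qP 0%N; have [q1 _] := qP 1%N.
have {}IH : engel_partial_sum (fun i => q i.+1) n <= ((q 1).-1%:R)^-1 :> R.
  by apply: IH => i; apply: qP.
case: (q 0%N) q0 q01 => // -[//|m] _ mq /=.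
have {}IH : engel_partial_sum (fun i => q i.+1) n <= m.+1%:R^-1 :> R.
  apply: le_trans IH _; rewrite lef_pV2 ?posrE ?ltr0n//;
    last by case: (q 1%N) q1 => // -[].
  by rewrite ler_nat; case: (q 1%N) mq.
rewrite ler_pdivrMr ?ltr0Sn//; apply: le_trans (lerD (lexx 1) IH) _.
by rewrite -[m.+2%:R]natr1 mulrDr mulr1 mulVf// pnatr_eq0.
Qed.

Lemma engel_partial_sum_nondecreasing {R : realType} (q : nat -> nat) :
  nondecreasing_seq (@engel_partial_sum R q).
Proof.
apply/nondecreasing_seqP => n.
rewrite /engel_partial_sum /series /= big_nat_recr//= lerDl invr_ge0.
by apply: prodr_ge0 => i _; rewrite ler0n.
Qed.

Lemma engel_shift {R : realType} (x : R) (q : nat -> nat) :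
  is_engel_expansion x q ->
  is_engel_expansion ((q 0)%:R * x - 1) (fun n => q n.+1).
Proof.
move=> [qP qx]; split=> [n|]; first exact: qP.
have q0 : (q 0)%:R != 0 :> R by rewrite pnatr_eq0; case: (qP 0%N);
  case: (q 0%N).
have -> : series (fun n => (\prod_(i < n.+1) (q i.+1)%:R : R)^-1) =
    (fun n => (q 0)%:R * engel_partial_sum q n.+1 - 1).
  apply/funext => n; rewrite engel_partial_sumS mulrC divfK//.
  by rewrite addrC addKr.
apply: cvgB; last exact: cvg_cst.
apply: cvgM; first exact: cvg_cst.
by rewrite -(cvg_shiftS (engel_partial_sum q)) in qx.
Qed.

(** The first digit is determined by these bounds.  The lower one is strict
    because an expansion is infinite. *)
Lemma engel_bounds {R : realType} (x : R) (q : nat -> nat) :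
  is_engel_expansion x q -> (q 0)%:R^-1 < x <= ((q 0).-1%:R)^-1.
Proof.
move=> [qP qx]; apply/andP; split; last first.
  by apply: (cvgr_to_le qx); near=> n; apply: engel_partial_sum_le.
have qpos i : 0 < (q i)%:R :> R by rewrite ltr0n; case: (qP i); case: (q i).
apply: (@lt_le_trans _ _ (engel_partial_sum q 2)).
  rewrite /engel_partial_sum /series /= !big_nat_recr//= big_geq// add0r
    big_ord1.
  rewrite ltrDl invr_gt0 big_ord_recr/= big_ord1.
  by rewrite mulr_gt0.
apply: (cvgr_to_ge qx); near=> n; apply: engel_partial_sum_nondecreasing.
by near: n; exists 2%N.
Unshelve. all: by end_near. Qed.

Lemma engel_first_digit {R : realType} (x : R) (q : nat -> nat) (k : nat) :
  is_engel_expansion x q -> (k.+1 < q 0)%N = (x <= k.+1%:R^-1).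
Proof.
move=> xq; have /andP[lx xu] := engel_bounds _ _ xq.
have [q0 _] := xq.1 0%N.
case: (q 0%N) q0 lx xu => // -[//|m] _ lx xu.
apply/idP/idP => [km|].
  by apply: le_trans xu _; rewrite lef_pV2 ?posrE ?ltr0Sn// ler_nat.
apply: contraTT; rewrite -leqNgt -ltNge => mk.
by apply: le_lt_trans lx; rewrite lef_pV2 ?posrE ?ltr0Sn// ler_nat.
Qed.

Lemma engel_first_digit_unique {R : realType} (x : R) (q q' : nat -> nat) :
  is_engel_expansion x q -> is_engel_expansion x q' -> q 0%N = q' 0%N.
Proof.
move=> xq xq'.
have H k : (k.+1 < q 0)%N = (k.+1 < q' 0)%N.
  by rewrite (engel_first_digit _ _ _ xq) (engel_first_digit _ _ _ xq').
have [a _] := xq.1 0%N; have [b _] := xq'.1 0%N.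
case: (q 0%N) (q' 0%N) H a b => [//|[//|k]] [//|[//|l]] H _ _.
have := H k; have := H l; rewrite !ltnS !leqnn => a b.
by apply/eqP; rewrite eqn_leq !ltnS a -b.
Qed.

Lemma engel_expansion_unique {R : realType} (x : R) (q q' : nat -> nat) :
  is_engel_expansion x q -> is_engel_expansion x q' -> q = q'.
Proof.
move=> xq xq'; apply/funext => n.
elim: n x q q' xq xq' => [|n IH] x q q' xq xq'.
  exact: engel_first_digit_unique xq xq'.
have e := engel_first_digit_unique _ _ _ xq xq'.
have := engel_shift _ _ xq'; rewrite -e => s'.
exact: (IH _ _ _ (engel_shift _ _ xq) s').
Qed.

(** The only digit compatible with [engel_bounds]. *)
Definition greedy_digit {R : realType} (x : R) : nat := (Num.truncn x^-1).+1.

Definition greedy_step {R : realType} (x : R) : R :=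
  (greedy_digit x)%:R * x - 1.

Lemma greedy_digitP {R : realType} (x : R) : 0 < x <= 1 ->
  (2 <= greedy_digit x)%N /\
  (greedy_digit x)%:R^-1 < x <= ((greedy_digit x).-1%:R)^-1.
Proof.
move=> /andP[x0 x1].
have v1 : 1 <= x^-1 by rewrite invf_ge1.
have /andP[tl tu] := Num.Theory.truncn_itv (le_trans ler01 v1).
have t1 : (1 <= Num.truncn x^-1)%N
  by rewrite Num.Theory.truncn_ge_nat// (le_trans ler01).
split; first by [].
rewrite /greedy_digit /=; apply/andP; split.
  by rewrite invf_plt ?posrE ?ltr0Sn.
by rewrite -[leLHS]invrK lef_pV2 ?posrE ?invr_gt0 ?ltr0n.
Qed.

Lemma greedy_stepP {R : realType} (x : R) : 0 < x <= 1 ->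
  0 < greedy_step x <= ((greedy_digit x).-1%:R)^-1.
Proof.
move=> /greedy_digitP[]; rewrite /greedy_step.
case: (greedy_digit x) => // -[//|m] _ /andP[lx xu] /=.
rewrite /= in xu.
have m0 : (0 : R) < m.+2%:R by rewrite ltr0Sn.
rewrite subr_gt0 -ltr_pdivrMl// mulr1 lx /=.
rewrite lerBlDr; apply: le_trans (ler_wpM2l (ltW m0) xu) _.
by rewrite -[m.+2%:R]natr1 mulrDl mul1r mulfV ?pnatr_eq0// addrC.
Qed.

Lemma greedy_step_itv {R : realType} (x : R) : 0 < x <= 1 ->
  0 < greedy_step x <= 1.
Proof.
move=> x01; have /andP[-> /le_trans->//] := greedy_stepP _ x01.
have [+ _] := greedy_digitP _ x01; case: (greedy_digit x) => // -[//|m] _.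
by rewrite invf_le1 ?ltr0Sn// ler1n.
Qed.

Lemma greedy_iter_itv {R : realType} (x : R) (n : nat) : 0 < x <= 1 ->
  0 < iter n greedy_step x <= 1.
Proof. by move=> x01; elim: n => //= n IH; apply: greedy_step_itv. Qed.

(** The digits do not decrease because each remainder is at most 1 / (q - 1),
    and the partial sums converge because the n-th error is a remainder, at
    most 1, divided by a product of n digits, at least 2 ^ n. *)
Lemma engel_expansion_exists {R : realType} (x : R) : 0 < x <= 1 ->
  is_engel_expansion x (fun n => greedy_digit (iter n greedy_step x)).
Proof.
move=> x01; split=> [n|].
  rewrite iterS; have := greedy_iter_itv _ n x01.
  move: (iter n _ x) => y y01.
  have [d2 _] := greedy_digitP _ y01; split=> //.
  have /andP[s0 s1] := greedy_stepP _ y01.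
  rewrite {2}/greedy_digit -(@prednK (greedy_digit y)) ?(leq_trans _ d2)// ltnS.
  rewrite Num.Theory.truncn_ge_nat ?invr_ge0 ?(ltW s0)//.
  by rewrite -[leLHS]invrK lef_pV2 ?posrE// (lt_le_trans s0).
have rem n : x - engel_partial_sum (fun n =>
  greedy_digit (iter n greedy_step x)) n
    = iter n greedy_step x / \prod_(i < n) (greedy_digit (iter i greedy_step
      x))%:R.
  elim: n x x01 => [|n IH] x x01.
    by rewrite /engel_partial_sum /series /= big_geq// big_ord0 divr1 subr0.
  have d0 : (greedy_digit x)%:R != 0 :> R by rewrite pnatr_eq0.
  rewrite engel_partial_sumS /= big_ord_recl /=.
  have := IH _ (greedy_step_itv _ x01).
  set s := engel_partial_sum _ n; set s' := engel_partial_sum _ n.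
  have -> : s' = s by congr (engel_partial_sum _ _); apply/funext => i;
    rewrite -iterSr.
  rewrite -iterSr /= => H.
  have -> : x - (1 + s) / (greedy_digit x)%:R =
    (greedy_step x - s) / (greedy_digit x)%:R.
    by rewrite /greedy_step; field.
  rewrite H invfM [in RHS]mulrCA mulrC; congr (_ * (_ / _)).
  by apply: eq_bigr => i _; rewrite -iterSr.
have c : (fun n => x - engel_partial_sum (fun n =>
  greedy_digit (iter n greedy_step x)) n)
     @ \oo --> (0 : R).
  apply: (@squeeze_cvgr _ _ _ _ (fun=> 0) (fun n => 2^-1 ^+ n)).
  - near=> n; rewrite rem.
    have /andP[y0 y1] := greedy_iter_itv _ n x01.
    have p0 : 2 ^+ n <= \prod_(i < n) (greedy_digit (iter i greedy_step x))%:R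
      :> R.
      elim: (n) => [|m IHm]; first by rewrite big_ord0 expr0.
      rewrite big_ord_recr exprSr /= ler_pM ?exprn_ge0//.
      by have [d2 _] := greedy_digitP _ (greedy_iter_itv _ m x01);
        rewrite ler_nat.
    have p1 : 0 < \prod_(i < n) (greedy_digit (iter i greedy_step x))%:R :> R.
      by apply: lt_le_trans p0; rewrite exprn_gt0.
    rewrite divr_ge0 ?(ltW y0) ?(ltW p1)//= exprVn.
    rewrite ler_pdivrMr//; apply: le_trans y1 _.
    by rewrite ler_pdivlMl ?exprn_gt0// mulr1.
  - exact: cvg_cst.
  - apply: cvg_expr; rewrite ger0_norm ?invr_ge0//; lra.
rewrite -[X in _ --> X]subr0.
rewrite [X in X @ _ --> _](_ : _ = (fun n => x - (x -
  engel_partial_sum (fun n => greedy_digit (iter n greedy_step x)) n))).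
  by apply: cvgB; [exact: cvg_cst|exact: c].
by apply/funext => n; rewrite subKr.
Unshelve. all: by end_near. Qed.

Lemma engel_expansionP {R : realType} (x : R) : 0 < x <= 1 ->
  is_engel_expansion x (engel_expansion x).
Proof.
move=> x01; rewrite /engel_expansion; case: xgetP => // H.
by have := H _ (engel_expansion_exists _ x01).
Qed.

Lemma engel_expansion_out {R : realType} (x : R) : ~ (0 < x <= 1) ->
  engel_expansion x = fun=> 2%N.
Proof.
move=> x01; rewrite /engel_expansion; case: xgetP => // q _ xq; exfalso;
  apply: x01.
have /andP[lx xu] := engel_bounds _ _ xq.
rewrite (le_lt_trans _ lx) ?invr_ge0//= (le_trans xu)//.
have [+ _] := xq.1 0%N; case: (q 0%N) => // -[//|m] _.
by rewrite invf_le1 ?ltr0Sn// ler1n.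
Qed.

Lemma engel_expansionS {R : realType} (x : R) (n : nat) : 0 < x <= 1 ->
  engel_expansion x n.+1 = engel_expansion ((engel_expansion x 0)%:R * x - 1) n.
Proof.
move=> x01; have xq := engel_expansionP _ x01.
have s := engel_shift _ _ xq.
have /andP[lx xu] := engel_bounds _ _ s.
have y01 : 0 < (engel_expansion x 0)%:R * x - 1 <= 1.
  apply: contrapT => H.
  rewrite (le_lt_trans _ lx) ?invr_ge0//= (le_trans xu)// in H.
  have [+ _] := s.1 0%N; case: (engel_expansion x 1%N) => // -[//|m] _.
  by rewrite invf_le1 ?ltr0Sn// ler1n.
by rewrite (engel_expansion_unique _ _ _ (engel_expansionP _ y01) s).
Qed.

Lemma engel_expansion_ge {R : realType} (x : R) (n : nat) : 0 < x <= 1 ->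
  (engel_expansion x 0 <= engel_expansion x n)%N.
Proof.
move=> x01; have [qP _] := engel_expansionP _ x01.
by elim: n => // n IH; apply: leq_trans IH _; case: (qP n).
Qed.

(** * The law of a digit *)

Lemma engel_expansion0_gt {R : realType} (x : R) (k : nat) : 0 < x <= 1 ->
  (k.+1 < engel_expansion x 0)%N = (x <= k.+1%:R^-1).
Proof. by move=> /engel_expansionP /engel_first_digit ->. Qed.

(** The same iterated means for the chain started from j + 1.  The factor
    1 / (j + 1) is the length of the interval of the numbers whose first digit
    exceeds j + 1, so that the values are lengths and not conditional
    probabilities. *)
Definition engel_tail_from {R : realType} (j n k : nat) : R :=
  iter n cesaro (fun i => (i <= j)%:R / j.+1%:R) k.

Lemma engel_tail_from0 {R : realType} (n k : nat) :
  engel_tail_from 0 n k = engel_tail n k :> R.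
Proof.
rewrite /engel_tail_from /engel_tail; congr (iter n _ _ k).
by apply/funext => i; rewrite divr1 leqn0.
Qed.

Lemma engel_tail_from_le {R : realType} (j n k : nat) : (k <= j)%N ->
  engel_tail_from j n k = j.+1%:R^-1 :> R.
Proof.
elim: n k => [|n IH] k kj; first by rewrite /engel_tail_from /= kj mul1r.
rewrite -[RHS](cesaro_cst _ k) /engel_tail_from /= /cesaro.
congr (_ / _); apply: eq_bigr => i _; apply: IH.
by rewrite (leq_trans _ kj)// -ltnS.
Qed.

Lemma engel_tail_from1_ge {R : realType} (j k : nat) : (j <= k)%N ->
  engel_tail_from j 1 k = k.+1%:R^-1 :> R.
Proof.
move=> jk; rewrite /engel_tail_from /= /cesaro -mulr_suml.
have -> : \sum_(i < k.+1) (i <= j)%:R = (minn k j).+1%:R :> R.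
  elim: (k) => [|m IH]; first by rewrite big_ord1 min0n.
  rewrite big_ord_recr /= IH -natrD; congr (_%:R).
  by case: (ltnP m j) => mj;
    [rewrite !(minn_idPl _) // ?(ltnW mj)// addn1 | rewrite !(minn_idPr _)//
    ?addn0// (leq_trans mj)].
by rewrite (minn_idPr jk) mulfV ?mul1r// pnatr_eq0.
Qed.

(** The decomposition by the first step of the chain.  The definition
    decomposes by the last step; the two agree because a condition on the
    starting point commutes with the Cesaro operator, which leaves the case
    n = 0 to check. *)
Lemma engel_tail_from_backward {R : realType} (j n k : nat) :
  engel_tail_from j n.+1 k =
  engel_tail_from j.+1 n.+1 k + engel_tail_from j n k / j.+2%:R :> R.
Proof.
elim: n k => [|n IH] k.
  have [kj|jk] := leqP k j.
    rewrite !engel_tail_from_le// ?(leq_trans kj)//.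
    have -> : j.+2%:R = j.+1%:R + 1 :> R by rewrite natr1.
    by field; rewrite ?nat1r ?natr1 -?[_ + 1 + 1]/_ !pnatr_eq0.
  rewrite !engel_tail_from1_ge ?(ltnW jk)// /engel_tail_from /=.
  by rewrite leqNgt jk /= !mul0r addr0.
rewrite {1}/engel_tail_from iterS.
rewrite [X in cesaro X](_ : _ = fun i => engel_tail_from j.+1 n.+1 i +
   j.+2%:R^-1 * engel_tail_from j n i).
  by rewrite cesaroD cesaroZ [_^-1 * _]mulrC.
by apply/funext => i; rewrite -/(engel_tail_from j n.+1 i) IH mulrC.
Qed.

(** Positions are parametrised by an affine map, so that the shift of an
    expansion, which is itself affine, stays within the family and no change of
    variables in the Lebesgue measure is necessary. *)
Definition engel_exceed {R : realType} (a b : R) (j n k : nat) : set R :=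
  [set y | 0 < a * y + b <= j.+1%:R^-1 /\
           (k.+1 < engel_expansion (a * y + b) n)%N].

Lemma affine_itv_measure {R : realType} (a b c d : R) : 0 < a -> c <= d ->
  let A := [set y | c < a * y + b <= d] in
  measurable A /\ lebesgue_measure A = ((d - c) / a)%:E.
Proof.
move=> a0 cd A.
have -> : A = `](c - b) / a, (d - b) / a]%classic.
  apply/seteqP; split=> y; rewrite /A /= in_itv /= ltr_pdivrMr// ler_pdivlMr//;
  by rewrite ltrBlDr lerBrDr mulrC.
split; first exact: measurable_itv.
rewrite lebesgue_measure_itv /= lte_fin.
have [lt|] := ltP.
  by rewrite -EFinB -mulrBl opprB addrA subrK.
rewrite ler_pM2r ?invr_gt0// lerD2r => dc.
have -> : d = c by apply/eqP; rewrite eq_le dc cd.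
by rewrite subrr mul0r.
Qed.

Lemma engel_exceed_full {R : realType} (a b : R) (j n k : nat) : (k <= j)%N ->
  engel_exceed a b j n k = [set y | 0 < a * y + b <= j.+1%:R^-1].
Proof.
move=> kj; apply/seteqP; split=> y /= => [[]//|y0]; split=> //.
have /andP[yp yj] := y0.
have y1 : 0 < a * y + b <= 1.
  by rewrite yp (le_trans yj)// invf_le1 ?ltr0Sn// ler1n.
apply: leq_trans (engel_expansion_ge _ n y1); rewrite engel_expansion0_gt//.
by rewrite (le_trans yj)// lef_pV2 ?posrE ?ltr0Sn// ler_nat.
Qed.

(** These bounds on the position say that the first digit is exactly j + 2. *)
Definition engel_exceed_shell {R : realType} (a b : R) (j n k : nat) : set R :=
  [set y | j.+2%:R^-1 < a * y + b <= j.+1%:R^-1 /\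
           (k.+1 < engel_expansion (a * y + b) n)%N].

Lemma engel_exceed_split {R : realType} (a b : R) (j n k : nat) :
  engel_exceed a b j n k =
    engel_exceed a b j.+1 n k `|` engel_exceed_shell a b j n k.
Proof.
have jj : j.+2%:R^-1 <= j.+1%:R^-1 :> R
  by rewrite lef_pV2 ?posrE ?ltr0Sn// ler_nat.
apply/seteqP; split=> y /=.
  move=> [/andP[y0 yj] d].
  by have [yl|yl] := leP (a * y + b) j.+2%:R^-1; [left|right]; split=> //;
    apply/andP.
move=> [|] [/andP[yl yu] d]; split=> //; apply/andP; split=> //.
  exact: le_trans yu jj.
by apply: lt_trans yl; rewrite invr_gt0 ltr0Sn.
Qed.

Lemma engel_digit0_shell {R : realType} (x : R) (j : nat) :
  j.+2%:R^-1 < x <= j.+1%:R^-1 -> engel_expansion x 0 = j.+2.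
Proof.
move=> /andP[xl xu].
have x1 : 0 < x <= 1.
  rewrite (lt_trans _ xl) ?invr_gt0 ?ltr0Sn//= (le_trans xu)//.
  by rewrite invf_le1 ?ltr0Sn// ler1n.
apply/eqP; rewrite eqn_leq; apply/andP; split.
  by rewrite leqNgt engel_expansion0_gt// -ltNge.
by rewrite engel_expansion0_gt.
Qed.

Lemma engel_exceed_shell0 {R : realType} (a b : R) (j k : nat) : (j < k)%N ->
  engel_exceed_shell a b j 0 k = set0.
Proof.
move=> jk; apply/seteqP; split=> y //= [/engel_digit0_shell ->].
by rewrite ltnS ltnNge jk.
Qed.

(** Where the first digit is known, removing it is an affine map. *)
Lemma engel_exceed_shellS {R : realType} (a b : R) (j n k : nat) :
  engel_exceed_shell a b j n.+1 k =
  engel_exceed (j.+2%:R * a) (j.+2%:R * b - 1) j n k.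
Proof.
have j2 : (0 : R) < j.+2%:R by rewrite ltr0Sn.
have j1 : j.+1%:R != 0 :> R by rewrite pnatr_eq0.
have e (y : R) : j.+2%:R * a * y + (j.+2%:R * b - 1) =
  j.+2%:R * (a * y + b) - 1 by ring.
have I (x : R) : (j.+2%:R^-1 < x <= j.+1%:R^-1) =
  (0 < j.+2%:R * x - 1 <= j.+1%:R^-1).
  rewrite subr_gt0 -ltr_pdivrMl// mulr1; congr (_ && _).
  rewrite lerBlDr -[X in _ = (_ <= X)](_ : j.+2%:R * j.+1%:R^-1 = _).
    by rewrite ler_pM2l.
  by rewrite -[j.+2%:R]natr1 mulrDl mul1r mulfV// addrC.
apply/seteqP; split=> y;
  rewrite /engel_exceed_shell /engel_exceed /= e -I => -[yI d]; split=> //;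
  have d0 := engel_digit0_shell _ _ yI; move: d; rewrite -d0 engel_expansionS//;
  have /andP[yl yu] := yI;
    rewrite (lt_trans _ yl) ?invr_gt0 ?ltr0Sn//= (le_trans yu)//;
  by rewrite invf_le1 ?ltr0Sn// ler1n.
Qed.

(** When j >= k the digit condition is automatic, since digits do not decrease.
    Below k, the shells are added one at a time, which is the first step
    decomposition [engel_tail_from_backward]. *)
Lemma engel_exceed_measure_of_shells {R : realType} (n j k : nat) (a b : R) : 0
  < a ->
  (forall i, (i < k)%N -> measurable (engel_exceed_shell a b i n k) /\
    lebesgue_measure (engel_exceed_shell a b i n k) =
      (engel_tail_from i n k / i.+2%:R / a)%:E) ->
  measurable (engel_exceed a b j n k) /\
  lebesgue_measure (engel_exceed a b j n k) = (engel_tail_from j n.+1 k / a)%:E.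
Proof.
move=> a0 shell.
have [d] : {d | k <= j + d}%N by exists k; rewrite leq_addl.
elim: d j => [|d IHd] j jk.
  rewrite addn0 in jk; rewrite engel_tail_from_le// engel_exceed_full//.
  have i0 : 0 <= j.+1%:R^-1 :> R by rewrite invr_ge0.
  by have [mA lA] := affine_itv_measure a b _ _ a0 i0; rewrite subr0 in lA.
have [kj|jk'] := leqP k j.
  rewrite engel_tail_from_le// engel_exceed_full//.
  have i0 : 0 <= j.+1%:R^-1 :> R by rewrite invr_ge0.
  by have [mA lA] := affine_itv_measure a b _ _ a0 i0; rewrite subr0 in lA.
have [m1 l1] := IHd j.+1 ltac:(by rewrite addSnnS).
have [m2 l2] := shell j jk'.
rewrite engel_exceed_split; split; first exact: measurableU.
transitivity (lebesgue_measure (engel_exceed a b j.+1 n k) +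
              lebesgue_measure (engel_exceed_shell a b j n k))%E.
  apply: measureU => //.
  apply/seteqP; split=> y //= [[/andP[_ h1] _] [/andP[h2 _] _]].
  by have := le_lt_trans h1 h2; rewrite ltxx.
by rewrite l1 l2 -EFinD (engel_tail_from_backward j) mulrDl.
Qed.

Lemma engel_exceed_measure {R : realType} (n j k : nat) (a b : R) : 0 < a ->
  measurable (engel_exceed a b j n k) /\
  lebesgue_measure (engel_exceed a b j n k) = (engel_tail_from j n.+1 k / a)%:E.
Proof.
elim: n j a b => [|n IHn] j a b a0;
  apply: engel_exceed_measure_of_shells => // i ik.
  rewrite engel_exceed_shell0//; split => //.
  by rewrite measure0 /engel_tail_from /= leqNgt ik !mul0r.
have i2 : (0 : R) < i.+2%:R by rewrite ltr0Sn.
have [m l] := IHn i (i.+2%:R * a) (i.+2%:R * b - 1) (mulr_gt0 i2 a0).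
by rewrite engel_exceed_shellS; split=> //; rewrite l invfM mulrA.
Qed.

(** Outside of (0,1] the expansion is constantly 2 by convention, so for k > 0
    the event only concerns (0,1], where [engel_exceed_measure] gives its
    length. *)
Lemma uniform_engel_digit {R : realType} (d : measure_display)
    (T : measurableType d) (P : probability T R) (X : {RV P >-> R})
    (n k : nat) : uniform01 X -> (0 < k)%N ->
  measurable [set w | (k.+1 < engel_expansion (X w) n)%N] /\
  P [set w | (k.+1 < engel_expansion (X w) n)%N] = (engel_tail n.+1 k)%:E.
Proof.
move=> hX k0.
pose A := [set y : R | (k.+1 < engel_expansion y n)%N].
have A01 y : A y -> 0 < y <= 1.
  move=> Ay; apply: contrapT => y01; move: Ay.
  by rewrite /A /= engel_expansion_out// !ltnS leqNgt k0.
have AE : A = engel_exceed 1 0 0 n k.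
  apply/seteqP; split=> y; rewrite /engel_exceed /= mul1r addr0 invr1;
    last by case.
  by move=> Ay; split=> //; apply: A01.
have [mA lA] := engel_exceed_measure n 0 k 1 0 (@ltr01 R).
rewrite -AE divr1 engel_tail_from0 in mA lA.
split; first exact: (@measurable_funPTI _ _ _ _ X A mA).
transitivity (distribution P X A) => //.
rewrite hX// /uniform_prob integral_uniform_pdf.
have -> : A `&` `[0, 1] = A.
  by apply/setIidPl => y /A01 /andP[y0 y1] /=; rewrite in_itv /= (ltW y0).
transitivity (\int[lebesgue_measure]_(y in A) (1 : R)%:E)%E.
  apply: eq_integral => y /set_mem /A01 /andP[y0 y1].
  by rewrite /uniform_pdf (ltW y0) y1 subr0 invr1.
by rewrite integral_cst// mul1e.
Qed.

(** * The gamma density on the normal scale *)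

(** The gamma law of shape n + 1, centred at its mean n + 1 and scaled by its
    standard deviation; this is the shape attached to the digit of rank
    n + 1. *)
Definition std_gamma_tail {R : realType} (n : nat) (y : R) : R :=
  gamma_tail n.+1 (n.+1%:R + Num.sqrt n.+1%:R * y).

Definition std_gamma_pdf {R : realType} (n : nat) (y : R) : R :=
  Num.sqrt n.+1%:R * poisson n (n.+1%:R + Num.sqrt n.+1%:R * y).

Lemma is_derive_std_gamma_tail {R : realType} (n : nat) (y : R) :
  is_derive y 1 (std_gamma_tail n) (- std_gamma_pdf n y).
Proof.
set r := Num.sqrt n.+1%:R : R.
have h : is_derive y 1 (fun z : R => n.+1%:R + r * z) r.
  apply: (is_derive_eq (is_deriveD (is_derive_cst (n.+1%:R : R) y 1)
    (is_derive_funZ r (is_derive_id y 1)))).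
  by rewrite add0r mulr1.
have := @is_derive1_comp R (gamma_tail n.+1) _ y _ _ (is_derive_gamma_tail n _)
  h.
by rewrite mulNr mulrC.
Qed.

(** Both the error term f and z ^+ 3 - f are nondecreasing and vanish at 0: the
    derivative of f is z ^+ 2 / (1 + z), between 0 and 3 z ^+ 2. *)
Lemma ln1D_taylor2 {R : realType} (z : R) : `|z| <= 2^-1 ->
  `|ln (1 + z) - z + z ^+ 2 / 2| <= `|z| ^+ 3.
Proof.
move=> zh.
pose f (u : R) := ln (1 + u) - u + u ^+ 2 / 2.
have f0 : f 0 = 0 by rewrite /f addr0 ln1 expr0n /= mul0r subr0 addr0.
have df (u : R) : `|u| <= 2^-1 -> is_derive u 1 f (u ^+ 2 / (1 + u)).
  move=> uh; have u1 : 0 < 1 + u by move: uh; rewrite ler_norml => /andP[]; lra.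
  have h1 : is_derive u 1 (fun v : R => 1 + v) 1.
    apply: (is_derive_eq (is_deriveD (is_derive_cst (1 : R) u 1) (is_derive_id
      u 1))).
    by rewrite add0r.
  have h2 : is_derive u 1 (fun v : R => ln (1 + v)) ((1 + u)^-1 * 1).
    exact: (@is_derive1_comp R (@ln R) (fun v =>
      1 + v) u (1 + u)^-1 1 (@is_derive1_ln R (1 + u) u1) h1).
  have h3 : is_derive u 1 (fun v : R => v ^+ 2 / 2) u.
    under eq_fun do rewrite [_ / _]mulrC.
    apply: (is_derive_eq (is_derive_funZ 2^-1 (is_derive_funX 2 (is_derive_id u
      1)))).
    by rewrite /= expr1 mulr1; field.
  apply: (is_derive_eq (is_deriveD (is_deriveB h2 (is_derive_id u 1)) h3)).
  by field; rewrite gt_eqF.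
have dg (u : R) : `|u| <= 2^-1 ->
    is_derive u 1 (fun v => v ^+ 3 - f v) (3 * u ^+ 2 - u ^+ 2 / (1 + u)).
  move=> uh; apply: (is_derive_eq (is_deriveB (is_derive_funX 3 (is_derive_id u
    1)) (df u uh))).
  by rewrite /= mulr1.
have df0 (u : R) : `|u| <= 2^-1 -> 0 <= u ^+ 2 / (1 + u) <= 3 * u ^+ 2.
  move=> uh; have u1 : 0 < 1 + u by move: uh; rewrite ler_norml => /andP[]; lra.
  rewrite divr_ge0 ?sqr_ge0 ?(ltW u1)//= ler_pdivrMr//.
  rewrite mulrC mulrA mulrC ler_peMr ?sqr_ge0//.
  by move: uh; rewrite ler_norml => /andP[]; lra.
have mono a b : a <= b -> `|a| <= 2^-1 -> `|b| <= 2^-1 ->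
    f a <= f b /\ a ^+ 3 - f a <= b ^+ 3 - f b.
  move=> ab ah bh.
  have inab (u : R) : a <= u <= b -> `|u| <= 2^-1.
    by move: ah bh; rewrite !ler_norml => /andP[? ?] /andP[? ?] /andP[? ?];
      apply/andP; split; lra.
  split.
    apply: (le_of_derive_ge0 (df := fun u => u ^+ 2 / (1 + u))) =>
      // u /inab uh.
      exact: df.
    by have /andP[] := df0 u uh.
  apply: (@le_of_derive_ge0 _ (fun v => v ^+ 3 - f v) (fun u =>
    3 * u ^+ 2 - u ^+ 2 / (1 + u))) => // u /inab uh.
    exact: dg.
  by rewrite subr_ge0; have /andP[] := df0 u uh.
have h0 : `|0 : R| <= 2^-1 by rewrite normr0 invr_ge0.
rewrite -/(f z).
have [z0|z0] := leP 0 z.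
  have [] := mono _ _ z0 h0 zh; rewrite f0 expr0n /= subr0 => a b.
  by rewrite [`|z|]ger0_norm// ger0_norm// -subr_ge0.
have [] := mono _ _ (ltW z0) zh h0; rewrite f0 expr0n /= subr0 => a b.
rewrite [`|z|]ltr0_norm// ler0_norm// exprNn -signr_odd /= expr1 mulN1r lerN2.
by rewrite -subr_le0.
Qed.

(** Exact form of the ratio of the two densities: in the logarithm of the gamma
    density, N (ln (1 + z) - z) contributes - y ^+ 2 / 2 to second order, and
    the exponent n instead of N = n + 1 contributes - ln (1 + z). *)
Lemma std_gamma_pdfE {R : realType} (n : nat) (y : R) :
  let z := y / Num.sqrt n.+1%:R in `|z| <= 2^-1 ->
  std_gamma_pdf n y = std_gamma_pdf n 0 / phi 0 * phi y *
    expR (n.+1%:R * (ln (1 + z) - z + z ^+ 2 / 2) - ln (1 + z)).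
Proof.
move=> z zh.
set N : R := n.+1%:R; set r := Num.sqrt N.
have N0 : 0 < N by rewrite ltr0Sn.
have r0 : 0 < r by rewrite sqrtr_gt0.
have r2 : r ^+ 2 = N by rewrite sqr_sqrtr// ltW.
have z1 : 0 < 1 + z by move: zh; rewrite ler_norml => /andP[]; lra.
have yE : r * y = N * z by rewrite /z -/N -/r -r2; field; rewrite gt_eqF.
have y2 : N * (z ^+ 2 / 2) = y ^+ 2 / 2.
  by rewrite /z -/N -/r -r2; field; rewrite gt_eqF.
rewrite /std_gamma_pdf -/N -/r mulr0 addr0 yE.
have -> : N + N * z = N * (1 + z) by ring.
have p0 := phi_gt0 (0 : R).
rewrite [phi y]phiE -y2.
have -> : expR (N * (ln (1 + z) - z + z ^+ 2 / 2) - ln (1 + z)) =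
    (1 + z) ^+ n * expR (- (N * z)) * expR (N * (z ^+ 2 / 2)).
  have -> : (1 + z) ^+ n = expR (n%:R * ln (1 + z)).
    by rewrite expRM_natl lnK// posrE.
  rewrite -!expRD; congr expR; rewrite /N -natr1; ring.
rewrite /poisson exprMn.
have -> : expR (- (N * (1 + z))) = expR (- N) * expR (- (N * z)).
  by rewrite -expRD; congr expR; ring.
rewrite [expR (- (N * (z ^+ 2 / 2)))]expRN.
have f0 : n`!%:R != 0 :> R by rewrite pnatr_eq0 -lt0n fact_gt0.
field.
by rewrite f0 !gt_eqF ?expR_gt0.
Qed.

(** The ratio of the two densities at the centre.  It tends to 1 by Stirling's
    formula, but [std_gamma_normal] obtains this from the total masses. *)
Definition gamma_scale {R : realType} (n : nat) : R :=
  std_gamma_pdf n 0 / phi 0.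

Lemma std_gamma_pdf_local {R : realType} (n : nat) (B theta y : R) :
  1 <= B -> theta <= 2^-1 -> B ^+ 3 <= theta * Num.sqrt n.+1%:R -> `|y| <= B ->
  gamma_scale n * expR (- (3 * theta)) * phi y <= std_gamma_pdf n y
    <= gamma_scale n * expR (3 * theta) * phi y.
Proof.
move=> B1 th Br yB; set kappa := gamma_scale n.
set N : R := n.+1%:R; set r := Num.sqrt N.
have N0 : 0 < N by rewrite ltr0Sn.
have r0 : 0 < r by rewrite sqrtr_gt0.
have r2 : r ^+ 2 = N by rewrite sqr_sqrtr// ltW.
set z := y / r.
have zr : `|z| = `|y| / r by rewrite normrM normfV (gtr0_norm r0).
have BB : B <= B ^+ 3 by rewrite -[leLHS]expr1 ler_weXn2l.
have zt : `|z| <= theta.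
  by rewrite zr ler_pdivrMr// (le_trans yB)// (le_trans BB).
have zh : `|z| <= 2^-1 := le_trans zt th.
have t3 : N * `|z| ^+ 3 <= theta.
  have -> : N * `|z| ^+ 3 = `|y| ^+ 3 / r.
    by rewrite zr -r2; field; rewrite gt_eqF.
  by rewrite ler_pdivrMr// (le_trans _ Br)// lerXn2r// nnegrE// (le_trans
    ler01).
have tay := ln1D_taylor2 _ zh.
have lnz : `|ln (1 + z)| <= 2 * `|z|.
  have -> : ln (1 + z) = (ln (1 + z) - z + z ^+ 2 / 2) + (z - z ^+ 2 / 2)
    by ring.
  apply: le_trans (ler_normD _ _) _;
    apply: le_trans (lerD tay (ler_normB _ _)) _.
  rewrite (normrM (z ^+ 2)) normrX [`|2^-1|]ger0_norm ?invr_ge0//.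
  have : 0 <= `|z| by []. by nra.
have e : `|N * (ln (1 + z) - z + z ^+ 2 / 2) - ln (1 + z)| <= 3 * theta.
  apply: le_trans (ler_normB _ _) _; rewrite normrM (gtr0_norm N0).
  apply: le_trans (lerD (ler_wpM2l (ltW N0) tay) lnz) _.
  by lra.
rewrite (std_gamma_pdfE _ _ zh) -/N -/r -/z -/(gamma_scale n) -/kappa.
have k0 : 0 <= kappa * phi y.
  rewrite mulr_ge0 ?(ltW (phi_gt0 _))// divr_ge0 ?(ltW (phi_gt0 _))//.
  by rewrite mulr_ge0 ?sqrtr_ge0// poisson_ge0// mulr0 addr0 ltW.
move: e; rewrite ler_norml => /andP[el eu].
by apply/andP; split; [rewrite mulrAC|rewrite [leRHS]mulrAC];
  rewrite ler_wpM2l// ler_expR.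
Qed.

(** Geometric domination: for t > n + 1 the Poisson weights decrease from index
    n down to 0 at least as fast as the powers of (n + 1) / t. *)
Lemma gamma_tail_upper {R : realType} (n : nat) (t : R) : 0 <= t ->
  (t - n.+1%:R) * gamma_tail n.+1 t <= t * poisson n t.
Proof.
move=> t0; elim: n => [|n IH].
  rewrite /gamma_tail big_ord1 ler_wpM2r ?poisson_ge0//; lra.
rewrite gamma_tailS.
have p0 := poisson_ge0 n.+1 t t0; have h0 := gamma_tail_ge0 n.+1 t t0.
have pS := poissonS n t; rewrite -pS in IH.
rewrite -[n.+2%:R]natr1.
move: (poisson n.+1 t) (gamma_tail n.+1 t) (n.+1%:R : R) IH p0 h0 =>
  p h m IH p0 h0.
lra.
Qed.

(** The function u * poisson n u has derivative (n + 1 - u) * poisson n u, which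
    on [0, t] is at least n + 1 - t times the gamma density. *)
Lemma gamma_tail_lower {R : realType} (n : nat) (t : R) : 0 <= t ->
  t < n.+1%:R ->
  (n.+1%:R - t) * (1 - gamma_tail n.+1 t) <= t * poisson n t.
Proof.
move=> t0 tn; set N : R := n.+1%:R.
have nt : 0 < N - t by rewrite subr_gt0.
have d (u : R) : is_derive u 1 (fun v =>
  v * poisson n v) ((N - u) * poisson n u).
  have -> : (fun v : R => v * poisson n v) = (fun v => N * poisson n.+1 v).
    by apply/funext => v; rewrite poissonS.
  apply: (is_derive_eq (is_derive_funZ N (is_derive_poissonS n u))).
  by rewrite mulrBr poissonS -mulrBl.
have H : 0 * poisson n 0 + (N - t) * gamma_tail n.+1 0 <=
         t * poisson n t + (N - t) * gamma_tail n.+1 t.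
  apply: (@le_of_derive_ge0 _ (fun v =>
    v * poisson n v + (N - t) * gamma_tail n.+1 v)
    (fun u => (N - u) * poisson n u + (N - t) * - poisson n u)) =>
      // u /andP[u0 ut].
    exact: is_deriveD (d u) (is_derive_funZ (N - t) (is_derive_gamma_tail n u)).
  rewrite mulrN -mulNr -mulrDl mulr_ge0 ?poisson_ge0//; lra.
by move: H; rewrite gamma_tail_at0 mul0r add0r mulr1 mulrBr mulr1; lra.
Qed.

Lemma std_gamma_right_tail {R : realType} (n : nat) (B : R) :
  1 <= B -> B <= Num.sqrt n.+1%:R ->
  std_gamma_tail n B <= 2 * std_gamma_pdf n B.
Proof.
move=> B1 Br; rewrite /std_gamma_tail /std_gamma_pdf.
set N : R := n.+1%:R; set r := Num.sqrt N.
have N0 : 0 < N by rewrite ltr0Sn.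
have r0 : 0 < r by rewrite sqrtr_gt0.
have r2 : r ^+ 2 = N by rewrite sqr_sqrtr// ltW.
have t0 : 0 <= N + r * B
  by rewrite addr_ge0 ?mulr_ge0 ?(ltW N0) ?(ltW r0)// (le_trans ler01).
have h0 := gamma_tail_ge0 n.+1 _ t0; have p0 := poisson_ge0 n _ t0.
have := gamma_tail_upper n _ t0; rewrite -/N -/r addrAC subrr add0r => H.
rewrite -(ler_pM2l r0).
apply: le_trans (_ : _ <= r * B * gamma_tail n.+1 (N + r * B)) _.
  by rewrite -mulrA ler_wpM2l ?(ltW r0)// ler_peMl.
apply: le_trans H _; rewrite [leRHS](_ : _ = 2 * N * poisson n (N + r * B)).
  rewrite ler_wpM2r// mulr_natl mulr2n lerD2l -r2 expr2 ler_wpM2l// ltW//.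
by rewrite -r2; ring.
Qed.

Lemma std_gamma_lefttail {R : realType} (n : nat) (B : R) :
  1 <= B -> B < Num.sqrt n.+1%:R ->
  1 - std_gamma_tail n (- B) <= std_gamma_pdf n (- B).
Proof.
move=> B1 Br; rewrite /std_gamma_tail /std_gamma_pdf.
set N : R := n.+1%:R; set r := Num.sqrt N.
have N0 : 0 < N by rewrite ltr0Sn.
have r0 : 0 < r by rewrite sqrtr_gt0.
have r2 : r ^+ 2 = N by rewrite sqr_sqrtr// ltW.
have rB : 0 < r * B by rewrite mulr_gt0// (lt_le_trans ltr01).
have t0 : 0 <= N + r * - B
  by rewrite -r2 expr2 -mulrDr mulr_ge0 ?(ltW r0)// subr_ge0 ltW.
have tN : N + r * - B < N by rewrite mulrN gtrDl oppr_lt0.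
have h1 := gamma_tail_le1 n.+1 _ t0; have p0 := poisson_ge0 n _ t0.
have := gamma_tail_lower n _ t0 tN; rewrite -/N -/r => H.
rewrite -(ler_pM2l r0).
apply: le_trans (_ : _ <= r * B * (1 - gamma_tail n.+1 (N + r * - B))) _.
  by rewrite -mulrA ler_wpM2l ?(ltW r0)// ler_peMl// subr_ge0.
move: H; rewrite {1}mulrN opprD opprK addrA subrr add0r => H.
apply: le_trans H _; rewrite [leRHS]mulrA -expr2 r2 ler_wpM2r//.
exact: ltW.
Qed.

Lemma std_gamma_increment {R : realType} (n : nat) (B theta x y : R) :
  1 <= B -> theta <= 2^-1 -> B ^+ 3 <= theta * Num.sqrt n.+1%:R ->
  - B <= x -> x <= y -> y <= B ->
  gamma_scale n * expR (- (3 * theta)) * (Phi y - Phi x)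
    <= std_gamma_tail n x - std_gamma_tail n y
    <= gamma_scale n * expR (3 * theta) * (Phi y - Phi x).
Proof.
move=> B1 th Br Bx xy yB.
set k := gamma_scale n * _; set K := gamma_scale n * expR (3 * theta).
have loc u : x <= u <= y -> k * phi u <= std_gamma_pdf n u <= K * phi u.
  move=> /andP[xu uy]; apply: (std_gamma_pdf_local _ B) => //.
  by rewrite ler_norml (le_trans Bx)//= (le_trans uy).
have d (c u : R) : is_derive u 1 (fun v => std_gamma_tail n v + c * Phi v)
    (- std_gamma_pdf n u + c * phi u).
  exact: is_deriveD (is_derive_std_gamma_tail n u) (is_derive_funZ c
    (is_derive_Phi u)).
have Hu : std_gamma_tail n x + K * Phi x <= std_gamma_tail n y + K * Phi y.
  apply: (@le_of_derive_ge0 _ (fun v => std_gamma_tail n v + K * Phi v)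
    (fun u => - std_gamma_pdf n u + K * phi u)) => // u ul.
  by rewrite addrC subr_ge0; case/andP: (loc u ul).
have Hl : - (std_gamma_tail n x + k * Phi x)
  <= - (std_gamma_tail n y + k * Phi y).
  apply: (@le_of_derive_ge0 _ (fun v => - (std_gamma_tail n v + k * Phi v))
    (fun u => - (- std_gamma_pdf n u + k * phi u))) => // u ul.
  by rewrite opprD opprK subr_ge0; case/andP: (loc u ul).
rewrite !mulrBr.
move: Hl Hu; clear; lra.
Qed.

(** Up to k <= K, the two constants of [std_gamma_increment], the gamma tail is
    the normal tail plus an error of order phi B.  The window [- B, B] together
    with the tails has mass 1 for both laws: this yields k (1 - 2 phi B) <= 1
    and 1 <= K (1 + 3 phi B), so k and K are close to 1 as soon as their ratio
    expR (6 theta) is. *)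
Lemma std_gamma_normal {R : realType} (n : nat) (B theta delta : R) :
  1 < B -> 0 <= theta <= 2^-1 -> B ^+ 3 <= theta * Num.sqrt n.+1%:R ->
  0 < delta <= 1 -> expR (6 * theta) <= 1 + delta / 4 -> phi B <= delta / 16 ->
  forall x, - B <= x <= B ->
  (1 - delta) * Phibar x - phi B <= std_gamma_tail n x
    <= (1 + delta) * Phibar x + 4 * phi B /\
  (1 - delta) * Phi x - phi B <= 1 - std_gamma_tail n x
    <= (1 + delta) * Phi x + 4 * phi B.
Proof.
move=> B1 /andP[t0 th] Br /andP[d0 d1] Ed pd x /andP[xl xu].
have B1' := ltW B1; have B0 : 0 < B := lt_trans ltr01 B1.
have r0 : 0 < Num.sqrt n.+1%:R :> R by rewrite sqrtr_gt0.
have BB : B < B ^+ 3 by rewrite -[ltLHS]expr1 ltr_eXn2l.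
have Brt : B < Num.sqrt n.+1%:R.
  by apply: (lt_le_trans BB); apply: (le_trans Br);
    rewrite ler_piMl ?(ltW r0)//; lra.
set k := gamma_scale n * expR (- (3 * theta)).
set K := gamma_scale n * expR (3 * theta).
set p := phi B; have p0 : 0 < p := phi_gt0 B; rewrite -/p in pd.
have sc0 : 0 <= gamma_scale n :> R.
  rewrite /gamma_scale divr_ge0 ?(ltW (phi_gt0 _))// /std_gamma_pdf mulr_ge0
    ?(ltW r0)//.
  by rewrite poisson_ge0// mulr0 addr0.
have k0 : 0 <= k by rewrite mulr_ge0 ?expR_ge0.
have K0 : 0 <= K by rewrite mulr_ge0 ?expR_ge0.
have kK : K = k * expR (6 * theta).
  by rewrite /k /K -mulrA -expRD; congr (_ * expR _); ring.
have inc u v : - B <= u -> u <= v -> v <= B ->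
    k * (Phi v - Phi u) <= std_gamma_tail n u - std_gamma_tail n v
      <= K * (Phi v - Phi u).
  exact: std_gamma_increment.
have loc u : `|u| <= B -> std_gamma_pdf n u <= K * phi u.
  by move=> uB; case/andP: (std_gamma_pdf_local n B theta u B1' th Br uB).
have right : std_gamma_tail n B <= 2 * (K * p).
  apply: le_trans (std_gamma_right_tail n B B1' (ltW Brt)) _.
  by rewrite ler_pM2l// loc// ger0_norm// ltW.
have left : 1 - std_gamma_tail n (- B) <= K * p.
  apply: le_trans (std_gamma_lefttail n B B1' Brt) _.
  by rewrite /p -phiN loc// normrN ger0_norm// ltW.
have HB0 : 0 <= std_gamma_tail n B.
  by rewrite gamma_tail_ge0// addr_ge0// mulr_ge0// ltW.
have HB1 : std_gamma_tail n (- B) <= 1.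
  apply: gamma_tail_le1; rewrite mulrN subr_ge0 -[leRHS](@sqr_sqrtr R)// expr2.
  by rewrite ler_pM2l// ltW.
have sp : Phibar B <= p := Phibar_le_phi B B1'.
have s0 := Phibar_ge0 B.
have PB : Phi B = 1 - Phibar B by rewrite /Phibar subKr.
have PNB : Phi (- B) = Phibar B := PhiN B.
have BBn : - B <= B by rewrite ge0_cp // ltW.
have /andP[il iu] := inc (- B) B (lexx _) BBn (lexx _).
rewrite PB PNB in il iu.
have K1 : 1 <= K * (1 + 3 * p).
  have : 0 <= K * Phibar B by rewrite mulr_ge0.
  by move: iu right left; rewrite !mulrBr !mulrDr; lra.
have k1 : k * (1 - 2 * p) <= 1.
  have : k * Phibar B <= k * p by rewrite ler_wpM2l.
  by move: il HB0 HB1; rewrite !mulrBr; lra.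
have E0 := expR_gt0 (6 * theta).
have Kd : K <= 1 + delta.
  have p2 : 0 < 1 - delta / 8 by lra.
  rewrite -(ler_pM2r p2).
  apply: (@le_trans _ _ (K * (1 - 2 * p))); first by rewrite ler_wpM2l//; lra.
  have dd : delta * delta <= 1 * delta by rewrite ler_wpM2r// ltW.
  apply: (@le_trans _ _ (1 + delta / 4)); last by nra.
  rewrite kK mulrAC; apply: le_trans (_ : 1 * expR (6 * theta) <= _);
    last by rewrite mul1r.
  by rewrite ler_pM2r.
have kd : 1 - delta <= k.
  have q1 : 0 < (1 + delta / 4) * (1 + 3 * (delta / 16)).
    by move: d0; clear => d0; rewrite mulr_gt0//; lra.
  rewrite -(ler_pM2r q1).
  apply: (@le_trans _ _ 1); first by move: d0 d1; clear => d0 d1; nra.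
  apply: le_trans K1 _; rewrite kK -mulrA ler_wpM2l//.
  by rewrite ler_pM ?(ltW E0)//; move: p0 pd; clear; lra.
have Kp : K * p <= 2 * p by rewrite ler_wpM2r ?(ltW p0)//; lra.
have /andP[jl ju] := inc x B xl xu (lexx _).
have /andP[ml mu] := inc (- B) x (lexx _) xl xu.
have F0 := Phi_ge0 x; have G0 := Phibar_ge0 x.
have GE : Phi B - Phi x = Phibar x - Phibar B by rewrite /Phibar; ring.
have GB : Phibar B <= Phibar x := Phibar_nonincreasing _ _ xu.
have FB : Phi (- B) <= Phi x := Phi_nondecreasing _ _ xl.
rewrite GE in jl ju; rewrite PNB in ml mu FB.
have Gs : 0 <= Phibar x - Phibar B by rewrite subr_ge0.
have Fs : 0 <= Phi x - Phibar B by rewrite subr_ge0.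
have a1 : K * (Phibar x - Phibar B) <= (1 + delta) * Phibar x.
  by rewrite ler_pM// gerBl.
have a2 : (1 - delta) * (Phibar x - Phibar B) <= k * (Phibar x - Phibar B).
  by rewrite ler_wpM2r.
have a3 : K * (Phi x - Phibar B) <= (1 + delta) * Phi x.
  by rewrite ler_pM// gerBl.
have a4 : (1 - delta) * (Phi x - Phibar B) <= k * (Phi x - Phibar B).
  by rewrite ler_wpM2r.
have a5 : (1 - delta) * Phibar B <= p.
  by apply: le_trans sp; rewrite ler_piMl// gerBl ltW.
rewrite mulrBr in a2; rewrite mulrBr in a4.
by split; apply/andP; split;
  move: a1 a2 a3 a4 a5 jl ju ml mu Kp right left HB0 HB1 p0; clear; lra.
Qed.

(** The ratio phi B / phi x is at most expR (- B ^+ 2 / 4) for x <= B / 4, and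
    Mills' inequality costs only a factor 1 + x; the resulting bound is
    weakened to a power of B. *)
Lemma phi_le_far {R : realType} (B x : R) : 1 <= B -> 0 <= x <= B / 4 ->
  phi B <= 64 * expR (3 / 2) / B * Phibar x.
Proof.
move=> B1 /andP[x0 xB]; have B0 : 0 < B := lt_le_trans ltr01 B1.
have e1 : phi B <= expR (- (B ^+ 2 / 4)) * phi x.
  rewrite phiE [in leRHS]phiE mulrCA ler_pM2l ?phi_gt0// -expRD ler_expR.
  have : x ^+ 2 <= (B / 4) ^+ 2 by rewrite lerXn2r ?nnegrE//; lra.
  rewrite expr_div_n; have := sqr_ge0 B; lra.
have e2 : expR (- (B ^+ 2 / 4)) <= 32 / B ^+ 4.
  rewrite expRN -[leRHS]invrK lef_pV2 ?posrE ?expR_gt0 ?invr_gt0 ?divr_gt0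
    ?exprn_gt0//.
  have B2 : 0 <= B ^+ 2 / 4 by rewrite divr_ge0 ?sqr_ge0.
  apply: le_trans (expR_ge1Dxn 1 B2).
  rewrite (_ : 2`!%:R = 2 :> R)// (_ : (32 / B ^+ 4)^-1 =
    (B ^+ 2 / 4) ^+ 2 / 2).
    by rewrite lerDr.
  by field; rewrite gt_eqF.
apply: le_trans e1 _.
apply: le_trans (ler_pM (expR_ge0 _) (ltW (phi_gt0 _)) e2 (phi_le_Phibar _ x0))
  _.
rewrite !mulrA ler_wpM2r ?Phibar_ge0//.
have -> : 64 * expR (3 / 2) / B = (32 / B ^+ 4 * expR (3 / 2)) * (2 * B ^+ 3).
  by field; rewrite gt_eqF.
rewrite ler_wpM2l ?mulr_ge0 ?expR_ge0 ?invr_ge0 ?exprn_ge0 ?(ltW B0)//.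
have : B <= B ^+ 3 by rewrite -[leLHS]expr1 ler_weXn2l.
lra.
Qed.

(** The density varies by at most a factor expR 1 between x - eta and x, because
    x eta <= 1; the increment of Phibar is thus of order eta * phi x, which
    Mills' inequality compares with Phibar x.  The constant is
    expR 1 * expR (3 / 2). *)
Lemma Phibar_shift {R : realType} (x eta : R) : 0 <= x -> 0 <= eta ->
  eta * (1 + x) <= 1 ->
  (1 - expR (5 / 2) * (eta * (1 + x))) * Phibar x <= Phibar (x + eta) /\
  Phibar (x - eta) <= (1 + expR (5 / 2) * (eta * (1 + x))) * Phibar x.
Proof.
move=> x0 e0 ex.
have eE : expR (5 / 2) = expR 1 * expR (3 / 2) :> R.
  by rewrite -expRD; congr expR; field.
have e1 : 1 <= expR 1 :> R by rewrite -expR0 ler_expR.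
have c0 := phi_gt0 x.
have mills : expR 1 * (eta * phi x)
  <= expR (5 / 2) * (eta * (1 + x)) * Phibar x.
  rewrite eE -!mulrA ler_wpM2l ?expR_ge0// mulrCA ler_wpM2l// mulrA.
  exact: phi_le_Phibar.
have w : eta * phi x <= expR 1 * (eta * phi x).
  by rewrite ler_peMl// mulr_ge0// ltW.
split.
  have /andP[_ h] := Phibar_diff_le _ _ x0 e0.
  rewrite mulrBl mul1r; lra.
pose c := expR 1 * phi x.
have d (u : R) : is_derive u 1 (fun z => c * z + Phibar z) (c - phi u).
  have h1 : c * 1 + - phi u = c - phi u by rewrite mulr1.
  exact: (is_derive_eq (is_deriveD (is_derive_funZ c (is_derive_id u 1))
    (is_derive_Phibar u)) h1).
have xe : x - eta <= x by lra.
have H : c * (x - eta) + Phibar (x - eta) <= c * x + Phibar x.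
  apply: (@le_of_derive_ge0 _ (fun z => c * z + Phibar z) (fun u =>
    c - phi u)) => // u /andP[ul uu].
  rewrite subr_ge0 /c phiE [in leRHS]phiE mulrCA ler_pM2l ?phi_gt0//.
  rewrite -expRD ler_expR.
  have h1 : (x - u) * (x + u) <= (x - u) * (2 * x) by rewrite ler_wpM2l; lra.
  have h2 : (x - u) * (2 * x) <= eta * (2 * x) by rewrite ler_wpM2r; lra.
  have : x ^+ 2 - u ^+ 2 = (x - u) * (x + u) by ring.
  lra.
have cE : c * eta = expR 1 * (eta * phi x) by rewrite /c; ring.
rewrite mulrDl mul1r; move: H; rewrite mulrBr cE; lra.
Qed.

(** * The balance of the parameters *)

(** The two alternatives are the bounds for an upper tail and for a lower tail;
    by symmetry they lead to the same estimate.  Four errors have to be small: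
    the factors 1 + delta and 1 - delta of [std_gamma_normal], those of
    [Phibar_shift], the terms in phi B, and expR (- B ^+ 2).  Each is given the
    share delta = eps / 4. *)
Lemma relative_error {R : realType} (eps : R) : 0 < eps <= 1 ->
  exists theta B0 : R, [/\ 0 < theta, 2 <= B0 &
  forall n B x v, B0 <= B -> B ^+ 3 <= theta * Num.sqrt n.+1%:R ->
    0 <= x <= B / 4 ->
    let eta := B ^+ 2 / Num.sqrt n.+1%:R in
    (std_gamma_tail n (x + eta) - expR (- B ^+ 2) <= v
      <= std_gamma_tail n (x - eta)
     \/ 1 - std_gamma_tail n (- (x + eta)) <= v
          <= 1 - std_gamma_tail n (- (x - eta)) + expR (- B ^+ 2)) ->
    `|v / Phibar x - 1| <= eps].
Proof.
move=> /andP[eps0 eps1].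
pose delta := eps / 4; have d0 : 0 < delta by rewrite divr_gt0.
have d1 : delta <= 4^-1 by rewrite /delta; lra.
have d1' : delta <= 1 by rewrite /delta; lra.
pose M : R := expR (5 / 2); have M0 : 0 < M := expR_gt0 _.
pose C : R := 64 * expR (3 / 2); have C0 : 0 < C by rewrite mulr_gt0 ?expR_gt0.
(* q converts expR (- B ^+ 2) into a multiple of phi B. *)
pose q : R := (phi 0)^-1; have q0 : 0 < q by rewrite invr_gt0 phi_gt0.
pose theta := Num.min (ln (1 + delta / 4) / 6) (Num.min 8^-1 (delta / (2 * M))).
(* 16 is for phi B <= delta / 16; 4 + q <= 16 + q bounds the two error terms. *)
pose B0 := Num.max 2 ((16 + q) * C / delta).
exists theta, B0.
have t0 : 0 < theta.
  rewrite !lt_min divr_gt0//=; last by apply: ln_gt0; lra.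
  by rewrite invr_gt0 ltr0n/= divr_gt0// mulr_gt0.
have t1 : theta <= ln (1 + delta / 4) / 6 by rewrite ge_min lexx.
have t2 : theta <= 8^-1 by rewrite /theta !ge_min lexx /= orbT.
have t3 : theta <= delta / (2 * M) by rewrite /theta !ge_min lexx !orbT.
split=> //; first by rewrite le_max lexx.
move=> n B x v; rewrite ge_max => /andP[B2 Bq] Br /andP[x0 xB] eta hv.
have Bpos : 0 < B by lra.
have B1 : 1 <= B by lra.
have r0 : 0 < Num.sqrt n.+1%:R :> R by rewrite sqrtr_gt0.
have eta0 : 0 <= eta by rewrite divr_ge0 ?sqr_ge0// ltW.
have etaB : eta * B <= theta.
  by rewrite /eta mulrAC -exprSr ler_pdivrMr.
have etax : eta * (1 + x) <= theta.
  by apply: le_trans etaB; rewrite ler_wpM2l//; lra.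
have eta1 : eta <= 1.
  have : eta * 1 <= eta * B by rewrite ler_wpM2l.
  lra.
have [sl su] := Phibar_shift x eta x0 eta0 ltac:(lra).
have Mx : M * (eta * (1 + x)) <= delta.
  apply: (@le_trans _ _ (M * (delta / (2 * M))));
    first by rewrite ler_wpM2l ?(ltW M0)//; lra.
  have -> : M * (delta / (2 * M)) = delta / 2 by field; rewrite gt_eqF.
  lra.
have CB : C / B * (16 + q) <= delta.
  rewrite mulrAC [C * _]mulrC ler_pdivrMr// [delta * _]mulrC -ler_pdivrMr//.
have CB0 : 0 <= C / B by rewrite divr_ge0// ltW.
have far y : 0 <= y <= B / 4 -> phi B <= C / B * Phibar y := phi_le_far B y B1.
have G0 := Phibar_gt0 x.
have p0 := phi_gt0 B.
have pd : phi B <= delta / 16.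
  have h : phi B <= C / B * Phibar 0 by apply: far; rewrite lexx divr_ge0// ltW.
  have : C / B * Phibar 0 <= C / B * 1.
    by rewrite ler_wpM2l// /Phibar lerBlDr lerDl Phi_ge0.
  have : 0 <= C / B * q by rewrite mulr_ge0// ltW.
  by move: CB; rewrite mulrDr; lra.
have eB : expR (- B ^+ 2) <= q * phi B.
  rewrite phiE mulrA mulVf ?mul1r ?gt_eqF ?phi_gt0// ler_expR.
  have := sqr_ge0 B; lra.
have small : 4 * phi B + expR (- B ^+ 2) <= delta * Phibar x.
  apply: (@le_trans _ _ ((16 + q) * phi B)); first by rewrite mulrDl;
    move: eB p0; clear; lra.
  apply: (@le_trans _ _ ((16 + q) * (C / B * Phibar x))).
    by rewrite ler_wpM2l ?far ?x0// addr_ge0 ?(ltW q0).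
  by rewrite mulrA ler_wpM2r ?(ltW G0)// mulrC.
have main y : - B <= y <= B ->
  (1 - delta) * Phibar y - phi B <= std_gamma_tail n y
    <= (1 + delta) * Phibar y + 4 * phi B /\
  (1 - delta) * Phi y - phi B <= 1 - std_gamma_tail n y
    <= (1 + delta) * Phi y + 4 * phi B.
  apply: (std_gamma_normal n B theta delta) => //.
  - by move: B2; clear; lra.
  - by rewrite (ltW t0)/=; move: t2; clear; lra.
  - by rewrite d0 /=; move: d1; clear; lra.
  rewrite -[leRHS]lnK ?posrE; last by move: d0; clear; lra.
  by rewrite ler_expR; move: t1; clear; lra.
have rng y : y = x + eta \/ y = x - eta -> - B <= y <= B.
  by case=> ->; apply/andP; split; move: x0 xB eta0 eta1 B2; clear; lra.
have rngN y : y = x + eta \/ y = x - eta -> - B <= - y <= B.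
  by case=> ->; apply/andP; split; move: x0 xB eta0 eta1 B2; clear; lra.
have up : v <= (1 + delta) * Phibar (x - eta) + 4 * phi B + expR (- B ^+ 2).
  have e0 := expR_ge0 (- B ^+ 2).
  case: hv => /andP[_ vu].
    by have [/andP[_ h] _] := main (x - eta) (rng _ (or_intror erefl));
      move: h vu e0; clear; lra.
  by have [_ /andP[_ h]] := main (- (x - eta)) (rngN _ (or_intror erefl));
    rewrite PhiN in h; move: h vu; clear; lra.
have lo : (1 - delta) * Phibar (x + eta) - 4 * phi B - expR (- B ^+ 2) <= v.
  have e0 := expR_ge0 (- B ^+ 2).
  case: hv => /andP[vl _].
    by have [/andP[h _] _] := main (x + eta) (rng _ (or_introl erefl));
      move: h vl e0 p0; clear; lra.
  by have [_ /andP[h _]] := main (- (x + eta)) (rngN _ (or_introl erefl));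
    rewrite PhiN in h; move: h vl e0 p0; clear; lra.
have su' : Phibar (x - eta) <= (1 + delta) * Phibar x.
  by apply: le_trans su _; rewrite ler_pM2r// lerD2l.
have sl' : (1 - delta) * Phibar x <= Phibar (x + eta).
  by apply: le_trans sl; rewrite ler_pM2r// lerD2l lerN2.
have b1 : (1 + delta) * Phibar (x - eta)
  <= (1 + delta) * ((1 + delta) * Phibar x).
  by rewrite ler_wpM2l// addr_ge0 ?(ltW d0).
have b2 : (1 - delta) * ((1 - delta) * Phibar x)
  <= (1 - delta) * Phibar (x + eta).
  by rewrite ler_wpM2l// subr_ge0; move: d1; clear; lra.
have dd : delta * (delta * Phibar x) <= delta * Phibar x.
  exact: (ler_piMl (mulr_ge0 (ltW d0) (ltW G0)) d1').
have dd0 : 0 <= delta * (delta * Phibar x) 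
  := (mulr_ge0 (ltW d0) (mulr_ge0 (ltW d0) (ltW G0))).
have epsE : eps * Phibar x = 4 * (delta * Phibar x) by rewrite /delta; field.
have Gn : Phibar x != 0 by rewrite gt_eqF.
rewrite -[X in _ - X](divff Gn) -mulrBl normrM normfV (gtr0_norm G0).
have upper_sum (F D D2 U p e : R) : U <= F + 2 * D + D2 -> v <= U + 4 * p + e ->
  4 * p + e <= D -> D2 <= D -> v - F <= 4 * D by clear; lra.
have lower_sum (F D D2 U p e : R) : F - 2 * D + D2 <= U -> U - 4 * p - e <= v ->
  4 * p + e <= D -> 0 <= D2 -> 0 <= D -> - (4 * D) <= v - F by clear; lra.
rewrite ler_pdivrMr// ler_norml epsE; apply/andP; split.
  apply: (lower_sum _ _ _ _ _ _ _ lo small dd0 (mulr_ge0 (ltW d0) (ltW G0))).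
  by apply: le_trans b2; rewrite le_eqVlt; apply/orP; left; apply/eqP; ring.
apply: (upper_sum _ _ _ _ _ _ _ up small dd).
by apply: (le_trans b1); rewrite le_eqVlt; apply/orP; left; apply/eqP; ring.
Qed.

(** * Digits against the normal law *)

(** A real threshold for a digit is replaced by an integer one.  The bound 4
    makes the integer large enough for [uniform_engel_digit]. *)
Lemma nat_threshold_lt {R : realType} (t : R) : 4 <= t ->
  exists k, [/\ (0 < k)%N, t - 1 <= k.+1%:R <= t &
    forall q : nat, (k.+1 < q)%N = (t < q%:R)].
Proof.
move=> t4; have t0 : 0 <= t by lra.
have /andP[tl tu] := Num.Theory.truncn_itv t0.
have : (2 <= Num.truncn t)%N by rewrite Num.Theory.truncn_ge_nat//; lra.
move: (Num.truncn t) tl tu => [//|[//|k]] tl tu _.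
exists k.+1; split=> [//||q].
  by rewrite tl andbT; move: tu; rewrite -[k.+3%:R]natr1; lra.
apply/idP/idP => [kq|tq].
  by apply: lt_le_trans tu _; rewrite ler_nat.
by rewrite -(ltr_nat R); apply: le_lt_trans tq.
Qed.

Lemma nat_threshold_le {R : realType} (t : R) : 4 <= t ->
  exists k, [/\ (0 < k)%N, t - 1 <= k.+1%:R <= t &
    forall q : nat, (k.+1 < q)%N = (t <= q%:R)].
Proof.
move=> t4; have [k [k0 /andP[kl ku] kq]] := nat_threshold_lt t t4.
have [kt|kt] := eqVneq k.+1%:R t; last first.
  exists k; split=> [//||q]; first by rewrite kl ku.
  rewrite le_eqVlt; case: eqP => [tq|_] //=.
  by rewrite -(ltr_nat R) -tq lt_neqAle kt ku.
have k2 : (2 < k)%N by rewrite -ltnS -(ler_nat R) kt; lra.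
case: k k2 kt {k0 kl ku kq} => [//|k] k2 kt.
exists k; split; first by case: (k) k2.
  by rewrite -kt -[k.+2%:R]natr1; apply/andP; split; lra.
by move=> q; rewrite -kt ler_nat.
Qed.

Lemma cvge0_squeeze {R : realType} (f : nat -> \bar R) :
  (forall e : R, 0 < e <= 1 -> \forall n \near \oo, (0 <= f n <= e%:E)%E) ->
  f @ \oo --> (0 : \bar R)%E.
Proof.
move=> H; apply/fine_cvgP; split.
  have /H : 0 < (1 : R) <= 1 by rewrite ltr01 lexx.
  apply: filterS => n /andP[f0 f1].
  by rewrite ge0_fin_numE// (le_lt_trans f1)// ltry.
apply/cvgr0Pnorm_le => e e0.
have /H : 0 < Num.min e 1 <= 1 by rewrite lt_min e0 ltr01 ge_min lexx orbT.
apply: filterS => n /andP[f0 f1].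
have ff : f n \is a fin_num by rewrite ge0_fin_numE// (le_lt_trans f1)// ltry.
rewrite /= ger0_norm ?fine_ge0// -lee_fin fineK// (le_trans f1)// lee_fin.
by rewrite ge_min lexx.
Qed.

Lemma engel_digit_gt0 {R : realType} (y : R) (n : nat) : (0 < engel_expansion y
  n)%N.
Proof.
have [/engel_expansionP [qP _]|/engel_expansion_out -> //] :=
  pselect (0 < y <= 1).
by apply: leq_trans (qP n).1.
Qed.

Lemma engel_Y_gt {R : realType} (n : nat) (x y : R) :
  (x < engel_Y n.+1 y) =
  (expR (n.+1%:R + Num.sqrt n.+1%:R * x) < (engel_expansion y n)%:R).
Proof.
have q0 : (0 : R) < (engel_expansion y n)%:R by rewrite ltr0n engel_digit_gt0.
rewrite /engel_Y ltr_pdivlMr ?sqrtr_gt0 ?ltr0Sn// ltrBrDl mulrC.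
by rewrite -[in RHS](lnK q0) ltr_expR.
Qed.

Lemma engel_Y_lt {R : realType} (n : nat) (x y : R) :
  (engel_Y n.+1 y < x) =
  ((engel_expansion y n)%:R < expR (n.+1%:R + Num.sqrt n.+1%:R * x)).
Proof.
have q0 : (0 : R) < (engel_expansion y n)%:R by rewrite ltr0n engel_digit_gt0.
rewrite /engel_Y ltr_pdivrMr ?sqrtr_gt0 ?ltr0Sn// ltrBlDl [x * _]mulrC.
by rewrite -[in RHS](lnK q0) ltr_expR.
Qed.

Lemma engel_tail_std {R : realType} (n k : nat) (B x : R) :
  let r := Num.sqrt n.+1%:R in
  1 <= B -> 1 <= n.+1%:R + r * x -> 0 <= n.+1%:R + r * x - B ^+ 2 ->
  expR (n.+1%:R + r * x) - 1 <= k.+1%:R <= expR (n.+1%:R + r * x) ->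
  std_gamma_tail n (x + B ^+ 2 / r) - expR (- B ^+ 2) <= engel_tail n.+1 k
    <= std_gamma_tail n (x - B ^+ 2 / r).
Proof.
move=> r B1 tau1 Bt kt.
have r0 : 0 < r by rewrite sqrtr_gt0 ltr0Sn.
have /andP[lo up] := engel_tail_sandwich n k _ (B ^+ 2) tau1 (sqr_ge0 B) kt.
have B21 : 1 <= B ^+ 2 by rewrite expr_ge1// (le_trans ler01).
have rB : r * (B ^+ 2 / r) = B ^+ 2 by rewrite mulrC divfK// gt_eqF.
rewrite /std_gamma_tail -/r mulrDr mulrBr rB !addrA lo /=.
by apply: le_trans up _; apply: gamma_tail_decr => //; rewrite lerD2l lerN2.
Qed.

(** The event on Y_n is the event that q_n - 1 exceeds some k with
    k + 1 close to expR (n + x sqrt n), or its complement, and [engel_tail_std]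
    puts its probability in the form required by [relative_error]. *)
Lemma exceedance_relative_error {R : realType} (d : measure_display)
    (T : measurableType d) (P : probability T R) (X : {RV P >-> R}) (eps : R) :
  uniform01 X -> 0 < eps <= 1 ->
  exists theta B0 : R, 0 < theta /\
  forall n B x, B0 <= B -> B ^+ 3 <= theta * Num.sqrt n.+1%:R ->
    0 <= x <= B / 4 ->
    `| fine (P [set w | x < engel_Y n.+1 (X w)]) / Phibar x - 1 | <= eps /\
    `| fine (P [set w | engel_Y n.+1 (X w) < - x]) / Phibar x - 1 | <= eps.
Proof.
move=> hX eps01.
have [theta [B0 [theta0 B02 main]]] := relative_error eps eps01.
exists (Num.min theta 1), B0; split; first by rewrite lt_min theta0 ltr01.
move=> n B x BB Br xB.
have r0 : 0 < Num.sqrt n.+1%:R :> R by rewrite sqrtr_gt0.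
have Bt : B ^+ 3 <= theta * Num.sqrt n.+1%:R.
  by apply: le_trans Br _; rewrite ler_pM2r// ge_min lexx.
have {}main v := main n B x v BB Bt xB.
have B1r : B ^+ 3 <= Num.sqrt n.+1%:R.
  by apply: le_trans Br _; rewrite ler_piMl ?(ltW r0)// ge_min lexx orbT.
have B2 : 2 <= B := le_trans B02 BB.
have B0' : 0 <= B by lra.
have B1 : 1 <= B by lra.
pose r : R := Num.sqrt n.+1%:R; pose N : R := n.+1%:R.
rewrite -/r in Br r0 main Bt B1r.
have r2 : N = r * r by rewrite -expr2 sqr_sqrtr.
have B2r : B ^+ 2 * 2 <= r.
  by apply: le_trans B1r; rewrite [leRHS]exprSr ler_wpM2l ?sqr_ge0.
have B4 : 4 <= B ^+ 2 by rewrite expr2 (_ : 4 = 2 * 2 :> R) ?ler_pM// -natrM.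
have BB2 : B <= B ^+ 2 by rewrite -[leLHS]expr1 ler_weXn2l.
have /andP[x0 xB4] := xB.
have rx : r * x <= r * r / 8.
  by rewrite -mulrA ler_wpM2l ?(ltW r0)//; move: xB4 BB2 B2r; clear; lra.
have rx0 : 0 <= r * x by rewrite mulr_ge0// ltW.
have r8 : 8 <= r by move: B4 B2r; clear; lra.
have rr : 8 * r <= r * r by rewrite ler_wpM2r// ltW.
have tauB (y : R) : y = x \/ y = - x ->
    [/\ 4 <= expR (N + r * y), 1 <= N + r * y & 0 <= N + r * y - B ^+ 2].
  move=> yx; have ryl : - (r * r / 8) <= r * y.
    by case: yx => ->; rewrite ?mulrN; move: rx rx0; clear; lra.
  have tau4 : 4 <= N + r * y by rewrite r2; move: ryl rr r8; clear; lra.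
  split.
  - by apply: le_trans (expR_ge1Dx _); move: tau4; clear; lra.
  - by move: tau4; clear; lra.
  by rewrite r2; move: ryl rr r8 B2r; clear; lra.
split.
  have [e4 t1 tB] := tauB x (or_introl erefl).
  have [k [k0 kt kq]] := nat_threshold_lt _ e4.
  have -> : [set w | x < engel_Y n.+1 (X w)] =
      [set w | (k.+1 < engel_expansion (X w) n)%N].
    by apply/seteqP; split=> w /=; rewrite engel_Y_gt kq.
  have [_ ->] := uniform_engel_digit _ _ P X n k hX k0.
  by apply: main; left; apply: engel_tail_std.
have [e4 t1 tB] := tauB (- x) (or_intror erefl).
have [k [k0 kt kq]] := nat_threshold_le _ e4.
have -> : [set w | engel_Y n.+1 (X w) < - x] =
    ~` [set w | (k.+1 < engel_expansion (X w) n)%N].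
  by apply/seteqP; split=> w /=; rewrite engel_Y_lt ltNge -/N -/r -kq => /negP.
have [mE PE] := uniform_engel_digit _ _ P X n k hX k0.
rewrite probability_setC// PE -EFinB.
apply: main; right.
have /andP[lo up] := engel_tail_std n k B (- x) B1 t1 tB kt.
have eD : - x - B ^+ 2 / r = - (x + B ^+ 2 / r) by rewrite opprD.
have eB : - x + B ^+ 2 / r = - (x - B ^+ 2 / r) by rewrite opprB addrC.
rewrite -/r eB in lo; rewrite -/r eD in up.
by rewrite lerD2l lerN2 up /=; move: lo; rewrite engel_tailS; clear; lra.
Qed.

Lemma powR6_root {R : realType} (n : nat) :
  ((n%:R : R) `^ (6%:R)^-1) ^+ 3 = Num.sqrt n%:R.
Proof.
rewrite -powR_mulrn ?powR_ge0// -powRrM -powR12_sqrt//; congr (_ `^ _).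
by field.
Qed.

Lemma cvgn_powR6_root {R : realType} (C : R) :
  \forall n \near \oo, C <= (n%:R : R) `^ (6%:R)^-1.
Proof.
have [C0|C0] := leP C 0; first by near=> n; rewrite (le_trans C0)// powR_ge0.
exists (Num.truncn (C ^+ 6)).+1 => // n /= nC.
have -> : C = (C ^+ 6) `^ (6%:R)^-1.
  by rewrite -powR_mulrn ?(ltW C0)// -powRrM mulfV ?pnatr_eq0// powRr1 ?ltW.
rewrite ge0_ler_powR ?invr_ge0 ?nnegrE ?exprn_ge0 ?(ltW C0)//.
have /andP[_ tu] := Num.Theory.truncn_itv (exprn_ge0 6 (ltW C0)).
by apply: le_trans (ltW tu) _; rewrite ler_nat.
Unshelve. all: by end_near. Qed.

Theorem corollary2p2 (R : realType) (d : measure_display)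
    (T : measurableType d) (P : probability T R) (X : {RV P >-> R})
    (hX : uniform01 X)
    (b : nat -> R)
    (b_gt0 : forall n : nat, (1 <= n)%N -> 0 < b n)
    (b_small : (fun n : nat => b n / (n%:R `^ (6%:R)^-1)) @ \oo --> (0 : R)) :
  ((fun n : nat => ereal_sup
     [set (`| fine (P [set w | x < engel_Y n (X w)]) / Phibar x - 1 |)%:E
        | x in [set x : R | 0 <= x <= b n]]) @ \oo --> (0 : \bar R)%E) /\
  ((fun n : nat => ereal_sup
     [set (`| fine (P [set w | engel_Y n (X w) < - x]) / Phibar x - 1 |)%:E
        | x in [set x : R | 0 <= x <= b n]]) @ \oo --> (0 : \bar R)%E).
Proof.
have unif (eps : R) : 0 < eps <= 1 -> \forall n \near \oo, 0 < b n /\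
    forall x, 0 <= x <= b n ->
    `| fine (P [set w | x < engel_Y n (X w)]) / Phibar x - 1 | <= eps /\
    `| fine (P [set w | engel_Y n (X w) < - x]) / Phibar x - 1 | <= eps.
  move=> eps01.
  have [theta [B0 [theta0 main]]] :=
    exceedance_relative_error _ _ P X eps hX eps01.
  (* c <= 1 gives c ^+ 3 <= c <= theta, and (c n^(1/6))^3 = c^3 sqrt n. *)
  pose c := Num.min theta 1.
  have c0 : 0 < c by rewrite lt_min theta0 ltr01.
  have ct : c <= theta by rewrite ge_min lexx.
  have c1 : c <= 1 by rewrite ge_min lexx orbT.
  have c34 : c ^+ 3 <= theta.
    by apply: le_trans ct; rewrite -[leRHS]expr1 ler_wiXn2l// ltW.
  have c4 : 0 < c / 4 by rewrite divr_gt0.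
  near=> n.
  have n0 : (0 < n)%N by near: n; exists 1%N.
  have small : `|b n / (n%:R `^ (6%:R)^-1)| <= c / 4.
    near: n; have /cvgr0Pnorm_le := b_small; exact.
  have large : B0 / c <= n%:R `^ (6%:R)^-1 by near: n; apply: cvgn_powR6_root.
  have s0 : 0 < n%:R `^ (6%:R)^-1 :> R by rewrite powR_gt0// ltr0n.
  have bs : b n <= c * n%:R `^ (6%:R)^-1 / 4.
    by rewrite mulrAC -ler_pdivrMr//; apply: le_trans small; apply: ler_norm.
  split; first exact: b_gt0.
  move=> x /andP[x0 xb].
  rewrite -(prednK n0) in large bs s0 *.
  apply: (main n.-1 (c * n.-1.+1%:R `^ (6%:R)^-1)).
  - by rewrite mulrC -ler_pdivrMr.
  - by rewrite exprMn powR6_root ler_wpM2r ?sqrtr_ge0.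
  - by rewrite x0 (le_trans xb)// -{1}(prednK n0).
have conv (f : nat -> R -> R) : (forall eps : R, 0 < eps <= 1 ->
    \forall n \near \oo, 0 < b n /\ forall x, 0 <= x <= b n ->
      `|f n x| <= eps) ->
    (fun n => ereal_sup [set (`|f n x|)%:E | x in [set x : R | 0 <= x <= b n]])
      @ \oo --> (0 : \bar R)%E.
  move=> H; apply: cvge0_squeeze => e /H; apply: filterS => n [bn fe].
  apply/andP; split.
    apply: (@le_trans _ _ (`|f n 0|)%:E); first by rewrite lee_fin.
    by apply: ereal_sup_ubound; exists 0 => //=; rewrite lexx ltW.
  by apply: ge_ereal_sup => _ [x xb <-]; rewrite lee_fin fe.
split; apply: (conv (fun n x => _ / Phibar x - 1)) => eps /unif;
  apply: filterS => n [bn h]; split=> // x /h[].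
Unshelve. all: by end_near. Qed.
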